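(* \textsc{Total Grundy Domination} is $\mathsf{W[1]}$-hard on bipartite graphs and on split graphs (i.e., it remains $\mathsf{W[1]}$-hard when the input graphs are restricted to bipartite graphs, and also when they are restricted to split graphs).
   Context: For a graph $G$ and vertex $v$, $N(v)$ denotes the open neighborhood. A sequence $(v_1,\dots,v_k)$ of pairwise distinct vertices of $G$ is a \emph{total dominating sequence} if for every $i$ the set $N(v_i)\setminus\bigcup_{j=1}^{i-1}N(v_j)$ is nonempty. \textsc{Total Grundy Domination}: Input: a graph $G$ and $k\in\mathbb{N}$. Parameter: $k$. Question: is there a total dominating sequence of $G$ of length at least $k$? A split graph is a graph whose vertex set can be partitioned into a clique and an independent set. *)

(* Defs.v *)
From mathcomp Require Import all_boot.

Set Implicit Arguments.
Unset Strict Implicit.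
Unset Printing Implicit Defensive.

(** * Machine model

    Programs of the WHILE language over binary trees (N. D. Jones,
    "Computability and Complexity"), with a finite number of variables per
    program.  Evaluating an expression costs the total size of the values of
    all its subexpressions, and every command adds one unit, so that no tree
    can be built in time less than its size (no sharing).  With this cost
    measure the model and multi-tape Turing machines simulate each other with
    polynomial overhead. *)

Inductive tree : Type := Leaf | Node of tree & tree.

Fixpoint tsize (x : tree) : nat :=
  if x is Node l r then (tsize l + tsize r).+1 else 1.

Definition tleft (x : tree) : tree := if x is Node l _ then l else Leaf.
Definition tright (x : tree) : tree := if x is Node _ r then r else Leaf.
Definition is_node (x : tree) : bool := if x is Node _ _ then true else false.

Inductive expr : Type :=
  | EVar of nat
  | ELeaf
  | ENode of expr & expr
  | ELeft of expr
  | ERight of expr.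

Definition store : Type := nat -> tree.

Definition upd (s : store) (i : nat) (x : tree) : store :=
  fun j => if j == i then x else s j.

Fixpoint eval (s : store) (e : expr) : tree :=
  match e with
  | EVar i => s i
  | ELeaf => Leaf
  | ENode e1 e2 => Node (eval s e1) (eval s e2)
  | ELeft e1 => tleft (eval s e1)
  | ERight e1 => tright (eval s e1)
  end.

Fixpoint ecost (s : store) (e : expr) : nat :=
  tsize (eval s e) +
  match e with
  | EVar _ | ELeaf => 0
  | ENode e1 e2 => ecost s e1 + ecost s e2
  | ELeft e1 | ERight e1 => ecost s e1
  end.

Inductive cmd : Type :=
  | Skip
  | Assign of nat & expr
  | Seq of cmd & cmd
  | If of expr & cmd & cmd
  | While of expr & cmd.

(* [exec c s t s']: from store [s], [c] halts after time exactly [t] in [s'];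
   a condition holds when its value is not [Leaf]. *)
Inductive exec : cmd -> store -> nat -> store -> Prop :=
  | ExecSkip s : exec Skip s 1 s
  | ExecAssign s i e :
      exec (Assign i e) s (ecost s e).+1 (upd s i (eval s e))
  | ExecSeq s1 s2 s3 c1 c2 t1 t2 :
      exec c1 s1 t1 s2 -> exec c2 s2 t2 s3 ->
      exec (Seq c1 c2) s1 (t1 + t2).+1 s3
  | ExecIfTrue s s' e c1 c2 t :
      is_node (eval s e) -> exec c1 s t s' ->
      exec (If e c1 c2) s (ecost s e + t).+1 s'
  | ExecIfFalse s s' e c1 c2 t :
      ~~ is_node (eval s e) -> exec c2 s t s' ->
      exec (If e c1 c2) s (ecost s e + t).+1 s'
  | ExecWhileEnd s e c :
      ~~ is_node (eval s e) -> exec (While e c) s (ecost s e).+1 s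
  | ExecWhileStep s1 s2 s3 e c t1 t2 :
      is_node (eval s1 e) -> exec c s1 t1 s2 -> exec (While e c) s2 t2 s3 ->
      exec (While e c) s1 (ecost s1 e + t1 + t2).+1 s3.

(* Input and output are in variable 0; all other variables start at [Leaf]. *)
Definition runs (p : cmd) (x : tree) (t : nat) (y : tree) : Prop :=
  exists2 s, exec p (upd (fun=> Leaf) 0 x) t s & s 0 = y.

(** * Encodings (numbers are in unary) *)

Definition enc_nat (n : nat) : tree := iter n (Node Leaf) Leaf.

Definition enc_bool (b : bool) : tree := if b then Node Leaf Leaf else Leaf.

Definition enc_seq (T : Type) (enc : T -> tree) (s : seq T) : tree :=
  foldr (fun x r => Node (enc x) r) Leaf s.

Lemma enc_nat_inj : injective enc_nat.
Proof. by elim=> [|m IHm] [|n] //= [/IHm ->]. Qed.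

Lemma enc_bool_inj : injective enc_bool.
Proof. by move=> [] []. Qed.

Lemma enc_seq_inj (T : Type) (enc : T -> tree) :
  injective enc -> injective (enc_seq enc).
Proof.
by move=> enc_inj; elim=> [|x s IHs] [|y r] //= [/enc_inj -> /IHs ->].
Qed.

Definition computable (f : nat -> nat) : Prop :=
  exists p, forall n, exists t, runs p (enc_nat n) t (enc_nat (f n)).

(** * Parameterized problems and W[1]-hardness *)

(* An instance is a pair (x, k) of an encoded object and a parameter.  [legal]
   singles out the admissible inputs: it is always true for a language
   L ⊆ Σ* × ℕ, and it expresses the restriction of a problem to a class of
   inputs, in which case only legal instances have to be treated, and only
   legal instances may be produced. *)
Record pproblem : Type := PProblem {
  legal : tree -> nat -> Prop;
  yes : tree -> nat -> Prop
}.

Definition enc_instance (x : tree) (k : nat) : tree := Node x (enc_nat k).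

Definition fpt_reducible (P Q : pproblem) : Prop :=
  exists (p : cmd) (f g : nat -> nat) (c : nat),
    [/\ computable f, computable g &
      forall x k, legal P x k ->
      exists x' k' t,
        [/\ runs p (enc_instance x k) t (enc_instance x' k'),
            t <= f k * tsize (enc_instance x k) ^ c,
            legal Q x' k',
            k' <= g k &
            yes P x k <-> yes Q x' k']].

(* A circuit is a list of gates in a topological order of its underlying DAG:
   the arguments of a gate are positions of earlier gates, and the last gate
   is the output. *)
Inductive gate : Type :=
  | GInput
  | GNot of nat
  | GAnd of seq nat
  | GOr of seq nat.

Definition circuit : Type := seq gate.

Definition gate_at (C : circuit) (i : nat) : gate := nth GInput C i.

Definition gate_args (g : gate) : seq nat :=
  match g with
  | GInput => [::]
  | GNot i => [:: i]
  | GAnd l | GOr l => l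
  end.

Definition is_input (g : gate) : bool := if g is GInput then true else false.

(* Not-gates have indegree 1, and- and or-gates have indegree at least 2. *)
Definition gate_arity_ok (g : gate) : bool :=
  match g with
  | GInput | GNot _ => true
  | GAnd l | GOr l => uniq l && (2 <= size l)
  end.

Definition circuit_wf (C : circuit) : Prop :=
  0 < size C /\
  forall i, i < size C ->
    gate_arity_ok (gate_at C i) /\ all (fun j => j < i) (gate_args (gate_at C i)).

Definition wire (C : circuit) : rel nat :=
  fun i j => i \in gate_args (gate_at C j).

(* [u :: p] is a path from an input node of [C] to its output node. *)
Definition io_path (C : circuit) (u : nat) (p : seq nat) : Prop :=
  [/\ u < size C, is_input (gate_at C u), path (wire C) u p
    & last u p = (size C).-1].

Definition depth_le (d : nat) (C : circuit) : Prop :=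
  forall u p, io_path C u p -> size p <= d.

Definition large (C : circuit) (i : nat) : bool :=
  2 < size (gate_args (gate_at C i)).

Definition weft_le (t : nat) (C : circuit) : Prop :=
  forall u p, io_path C u p -> count (large C) (u :: p) <= t.

(* [vs] lists the values of the earlier gates, so that an input gate is at
   position [size vs]. *)
Definition gate_value (a : nat -> bool) (vs : seq bool) (g : gate) : bool :=
  match g with
  | GInput => a (size vs)
  | GNot i => ~~ nth false vs i
  | GAnd l => all (nth false vs) l
  | GOr l => has (nth false vs) l
  end.

Definition circuit_value (a : nat -> bool) (C : circuit) : bool :=
  last false (foldl (fun vs g => rcons vs (gate_value a vs g)) [::] C).

Definition input_nodes (C : circuit) : seq nat :=
  [seq i <- iota 0 (size C) | is_input (gate_at C i)].

Definition weight (a : nat -> bool) (C : circuit) : nat :=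
  count a (input_nodes C).

Definition enc_gate (g : gate) : tree :=
  match g with
  | GInput => Node (enc_nat 0) Leaf
  | GNot i => Node (enc_nat 1) (enc_nat i)
  | GAnd l => Node (enc_nat 2) (enc_seq enc_nat l)
  | GOr l => Node (enc_nat 3) (enc_seq enc_nat l)
  end.

Definition enc_circuit (C : circuit) : tree := enc_seq enc_gate C.

Lemma enc_circuit_inj : injective enc_circuit.
Proof.
apply: enc_seq_inj => -[|i|l|l] [|j|r|r] //= [].
- by move/enc_nat_inj ->.
- by move/(enc_seq_inj enc_nat_inj) ->.
- by move/(enc_seq_inj enc_nat_inj) ->.
Qed.

Definition weft_class (t d : nat) (C : circuit) : Prop :=
  [/\ circuit_wf C, depth_le d C & weft_le t C].

(* Weighted Circuit Satisfiability restricted to circuits of weft at most [t]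
   and depth at most [d]. *)
Definition WCS (t d : nat) : pproblem := {|
  legal := fun x _ => exists2 C, weft_class t d C & x = enc_circuit C;
  yes := fun x k => exists C, [/\ weft_class t d C, x = enc_circuit C &
    exists a, weight a C = k /\ circuit_value a C]
|}.

Definition in_W (t : nat) (P : pproblem) : Prop :=
  exists d, fpt_reducible P (WCS t d).

Definition W1_hard (Q : pproblem) : Prop :=
  forall P, in_W 1 P -> fpt_reducible P Q.

(** * Graphs and total dominating sequences *)

Record sgraph : Type := SGraph {
  order : nat;
  adj : rel 'I_order;
  adj_sym : symmetric adj;
  adj_irr : irreflexive adj
}.

Definition N (G : sgraph) (v : 'I_(order G)) : {set 'I_(order G)} :=
  [set u | adj v u].

Definition total_dominating_sequence (G : sgraph) (l : nat)
    (v : l.-tuple 'I_(order G)) : Prop :=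
  uniq v /\
  forall i : 'I_l,
    N (tnth v i) :\: \bigcup_(j < l | j < i) N (tnth v j) != set0.

Definition bipartite (G : sgraph) : Prop :=
  exists A : {set 'I_(order G)},
    forall u v, adj u v -> (u \in A) != (v \in A).

Definition split_graph (G : sgraph) : Prop :=
  exists K : {set 'I_(order G)},
    (forall u v, u \in K -> v \in K -> u != v -> adj u v) /\
    (forall u v, u \notin K -> v \notin K -> ~~ adj u v).

Definition adj_matrix (G : sgraph) : seq (seq bool) :=
  [seq [seq adj u v | v <- enum 'I_(order G)] | u <- enum 'I_(order G)].

Definition enc_graph (G : sgraph) : tree :=
  enc_seq (enc_seq enc_bool) (adj_matrix G).

Lemma enc_graph_inj (G H : sgraph) :
  enc_graph G = enc_graph H ->
  exists eq_n : order G = order H,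
    forall u v, adj u v = adj (cast_ord eq_n u) (cast_ord eq_n v).
Proof.
move/(enc_seq_inj (enc_seq_inj enc_bool_inj)); rewrite /adj_matrix.
case: G H => [n e es ei] [m e' es' ei'] /= eqM.
have eq_n : n = m.
  by have := congr1 size eqM; rewrite 2!size_map !size_enum_ord.
subst m; exists erefl => u v; rewrite !cast_ord_id.
have /eq_in_map/(_ u) := eqM; rewrite mem_enum => /(_ isT).
by move/eq_in_map/(_ v); rewrite mem_enum => /(_ isT).
Qed.

(* Total Grundy Domination restricted to the graphs of a class [cls]. *)
Definition TotalGrundyDomination (cls : sgraph -> Prop) : pproblem := {|
  legal := fun x _ => exists2 G, cls G & x = enc_graph G;
  yes := fun x k => exists G, [/\ cls G, x = enc_graph G &
    exists (l : nat) (v : l.-tuple 'I_(order G)),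
      k <= l /\ total_dominating_sequence v]
|}.

(* Main.v *)
(* Degree.  Pack the relevant part of a circuit of weft 1 into a single number:
   a gate of large indegree contributes the number of its true arguments, and a
   binary gate above it the two numbers of its arguments, as digits.  As a
   function of the set [S] of true inputs this number is a polynomial of degree
   at most [2 ^ d], so inclusion-exclusion expresses it through its values on the
   subsets of [S] of bounded size.  Hence a weight-k assignment is checked by
   adding up f(k) tabulated terms modulo a polynomially large number.

   Constraints.  This is a binary constraint satisfaction problem with f(k)
   variables of polynomially large domain: a variable holds a partial sum and
   the few inputs which determine the next term.  All its constraints have the
   form [phi a b u_a = phi b a u_b].

   Graphs.  For a 0-1 matrix, the longest total dominating sequence of the
   bipartite graph it defines has twice the order of the largest triangular
   submatrix; making one side a clique changes this by at most 2.  The matrix is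
   indexed by the pairs (variable, value) and by dummies; two values conflict (1)
   or agree (0).  Each block of conflicts is of the form [phi a b u != phi b a v]
   and contributes at most 2 to a triangular submatrix, so that with many copies
   of each variable a submatrix of nearly full order must, for each variable [a],
   contain a row [u_a] followed later by the column [u_a].  Of two variables, one
   has its row before the column of the other, and the zero there makes their
   values agree. *)
From mathcomp Require Import all_boot all_algebra zify ring.
Require Import Defs.

Set Implicit Arguments.
Unset Strict Implicit.
Unset Printing Implicit Defensive.

(** The source is the class of weft-1 circuits of an arbitrary fixed depth, not a normal form of it.
    The value of a gate of large indegree is not of low degree, but the number of its true arguments
    is. So the logic from the large gates upwards is postponed: packing two digits is linear and
    keeps the degree, and the logic is applied once, to the final number. That number is below a
    bound polynomial in the circuit, so signed sums can be kept modulo this bound and the domains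
    stay polynomial. The form of the constraints is dictated by the graph side: an arbitrary block
    of conflicts may contain a large triangular submatrix, a block [f x != g y] none of order 3. The
    [m * m] blocks contribute at most [2 * (m * m)] whatever the number [L] of copies; with
    [L = 2 * (m * m) + 2], a variable lacking the wanted row and column loses more than these blocks
    and the clique can make up for. *)

Import GRing.Theory.

(** * Triangular submatrices and total dominating sequences *)

(* The pairs in [s] index a triangular submatrix of [r]: ones on the diagonal,
   zeros above it. *)
Definition chain (T : Type) (r : rel T) (s : seq (T * T)) : bool :=
  all (fun p => r p.1 p.2) s && pairwise (fun p q => ~~ r p.1 q.2) s.

Lemma chain_filter (T : Type) (r : rel T) (a : pred (T * T)) s :
  chain r s -> chain r (filter a s).
Proof.
move=> /andP[h1 h2]; rewrite /chain (pairwise_filter _ h2) andbT.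
by rewrite all_filter; apply: sub_all h1 => p /= ->; rewrite implybT.
Qed.

Lemma chain_map (T U : Type) (r : rel T) (r' : rel U) (f : T -> U) s :
  (forall x y, r x y = r' (f x) (f y)) ->
  chain r' [seq (f p.1, f p.2) | p <- s] = chain r s.
Proof.
move=> rr; rewrite /chain all_map pairwise_map; congr (_ && _).
  by apply: eq_all => p /=; rewrite rr.
by apply: eq_pairwise => p q /=; rewrite rr.
Qed.

Lemma sub_chain (T : eqType) (r r' : rel T) s :
  {in s &, forall p q, r p.1 q.2 = r' p.1 q.2} -> chain r s = chain r' s.
Proof.
move=> rr; rewrite /chain; congr (_ && _).
  by apply: eq_in_all => p ps; rewrite rr.
apply: (@eq_in_pairwise _ [in s]) => [p q ps qs|]; first by rewrite rr.
exact/allP.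
Qed.

(** Pairs [p], [q], [r] in this order would give [f p.1 = g q.2], [f p.1 = g r.2] and
    [f q.1 = g r.2], hence [f q.1 = g q.2], against the one on the diagonal at [q]. *)
Lemma chain_neq_le2 (T Y : eqType) (f g : T -> Y) s :
  chain (fun x y => f x != g y) s -> size s <= 2.
Proof.
case: s => [|p [|q [|r s]]] //; rewrite /chain /= !negbK.
move=> /andP[/and4P[_ /negP nq _ _] /and3P[/and3P[/eqP pq /eqP pr _] /andP[/eqP qr _] _]].
by case: nq; rewrite qr -pr pq.
Qed.

Lemma size_le_keys (T K : eqType) (key : T -> K) (ks : seq K) c s :
  all (fun p => key p \in ks) s ->
  (forall k, k \in ks -> count (fun p => key p == k) s <= c) ->
  size s <= c * size ks.
Proof.
elim: ks s => [|k ks IH] s /=; first by case: s => //= p s; rewrite in_nil.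
move=> h le; rewrite mulnS -(count_predC (fun p => key p == k)) leq_add //.
  by apply: le; rewrite mem_head.
rewrite -size_filter; apply: IH.
  rewrite all_filter; apply: sub_all h => p /=; rewrite in_cons.
  by case: eqP.
move=> k' k'ks; apply: leq_trans (le k' _); last by rewrite in_cons k'ks orbT.
by rewrite count_filter; apply: sub_count => p /= /andP[].
Qed.

Lemma filter_cons2_nth (T : eqType) (a : pred T) s p q t x0 :
  filter a s = [:: p, q & t] ->
  exists i j, [/\ i < j < size s, nth x0 s i = p & nth x0 s j = q].
Proof.
elim: s => //= x s IH; case: ifP => _.
  move=> [-> e]; have qs : q \in s.
    by have := mem_head q t; rewrite -e mem_filter => /andP[].
  by exists 0, (index q s).+1; rewrite /= nth_index // ltnS index_mem.
by move=> /IH[i [j [ij ni nj]]]; exists i.+1, j.+1.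
Qed.

Lemma finite_choice (T : Type) (x0 : T) (P : nat -> T -> Prop) m :
  (forall a, a < m -> exists x, P a x) -> exists f, forall a, a < m -> P a (f a).
Proof.
elim: m => [|m IH] h; first by exists (fun=> x0).
have [f hf] := IH (fun a am => h a (ltnW am)); have [x hx] := h m (leqnn _).
exists (fun a => if a == m then x else f a) => a; rewrite ltnS leq_eqVlt.
by case: eqP => [->|_ /hf].
Qed.

Section Chains.
Variable G : sgraph.

(** The second entry of a pair is a vertex newly dominated by the first: the diagonal gives
    adjacency, the zeros above it exclude the earlier vertices of the sequence. [chain_of_tds] reads
    this backwards, choosing a new neighbour for each vertex. *)
Lemma tds_of_chain (s : seq ('I_(order G) * 'I_(order G))) :
  chain (@adj G) s -> uniq (unzip1 s) ->
  exists v : (size s).-tuple 'I_(order G), total_dominating_sequence v.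
Proof.
move=> /andP[/allP h1 h2] us.
have sz : size (unzip1 s) == size s by rewrite size_map.
exists (Tuple sz); split=> // i; case: s us h1 h2 sz i => [|p0 s'] us h1 h2 sz; first by case.
set s := p0 :: s' in us h1 h2 sz *; move=> i.
have tn (j : 'I_(size s)) : tnth (Tuple sz) j = (nth p0 s j).1.
  by rewrite (tnth_nth p0.1) /= -(nth_map _ p0.1 fst) //= ltn_ord.
apply/set0Pn; exists (nth p0 s i).2; rewrite in_setD tn /N inE.
rewrite (h1 _ (mem_nth _ _)) ?ltn_ord // andbT.
apply/bigcupP => -[j ji]; rewrite tn inE.
by have /(pairwiseP p0)/(_ j i (ltn_ord j) (ltn_ord i) ji)/negbTE-> := h2.
Qed.

Lemma chain_of_tds l (v : l.-tuple 'I_(order G)) :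
  total_dominating_sequence v ->
  exists2 s : seq ('I_(order G) * 'I_(order G)), size s = l & chain (@adj G) s.
Proof.
move=> [_ h].
have hw (i : 'I_l) : exists w, adj (tnth v i) w && [forall j : 'I_l, (j < i) ==> ~~ adj (tnth v j) w].
  have /set0Pn[w] := h i; rewrite in_setD inE => /andP[/bigcupP nb ad].
  exists w; rewrite ad; apply/forallP => j; apply/implyP => ji; apply/negP => adj.
  by apply: nb; exists j; rewrite ?inE.
pose w i := xchoose (hw i).
exists [seq (tnth v i, w i) | i <- enum 'I_l]; first by rewrite size_map size_enum_ord.
apply/andP; split.
  by rewrite all_map; apply/allP => i _ /=; have /andP[] := xchooseP (hw i).
rewrite pairwise_map.
have : pairwise (fun i j : 'I_l => i < j) (enum 'I_l).
  have := pairwise_map (@nat_of_ord l) ltn (enum 'I_l); rewrite val_enum_ord => <-.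
  by rewrite -(sorted_pairwise ltn_trans) iota_ltn_sorted.
apply: sub_pairwise => i j ij /=.
by have /andP[_ /forallP/(_ i)] := xchooseP (hw j); rewrite ij.
Qed.

End Chains.

(* A vertex [((b, (a, l)), u)] is the [l]-th copy of the value [u] of the
   variable [a]; if [b] holds, it is the dummy of the cell [(a, l)], whose value
   [u] is irrelevant. *)
Section Gadget.
Variables (X D : eqType) (m L : nat) (phi : nat -> nat -> D -> X).
Variables (d0 : D) (dom : nat -> seq D).
Let vtx : Type := (bool * (nat * nat) * D)%type.

(** A dummy has ones exactly at the vertices of its own cell, so a diagonal pair containing a dummy
    stays inside one cell. Between two values the copy index is ignored. *)
Definition conflict (x y : vtx) : bool :=
  if x.1.1 || y.1.1 then x.1.2 == y.1.2
  else phi x.1.2.1 y.1.2.1 x.2 != phi y.1.2.1 x.1.2.1 y.2.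

Definition cells : seq (nat * nat) := [seq (a, l) | a <- iota 0 m, l <- iota 0 L].

Definition vertices : seq vtx :=
  [seq ((true, c), d0) | c <- cells] ++
  [seq ((false, c), u) | c <- cells, u <- dom c.1].

Definition solution (u : nat -> D) : Prop :=
  (forall a, a < m -> u a \in dom a) /\
  (forall a b, a < m -> b < m -> phi a b (u a) = phi b a (u b)).

Lemma conflict_sym : symmetric conflict.
Proof. by move=> x y; rewrite /conflict orbC eq_sym; case: ifP => // _; rewrite eq_sym. Qed.

Lemma mem_cells a l : ((a, l) \in cells) = (a < m) && (l < L).
Proof.
apply/allpairsP/idP => [[[b k]] /= [+ + [-> ->]]|/andP[am lL]].
  by rewrite !mem_iota /= => -> ->.
by exists (a, l); rewrite !mem_iota.
Qed.

Lemma uniq_cells : uniq cells.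
Proof. by apply: allpairs_uniq; rewrite ?iota_uniq // => -[a b] [c d]. Qed.

Lemma size_cells : size cells = m * L.
Proof. by rewrite size_allpairs !size_iota. Qed.

Lemma mem_vertices_real c u : ((false, c), u) \in vertices = (c \in cells) && (u \in dom c.1).
Proof.
rewrite mem_cat; have /negbTE-> /= : ((false, c), u) \notin [seq ((true, c), d0) | c <- cells].
  by apply/mapP => -[].
apply/allpairsPdep/andP => [[c' [u' [h1 h2 [-> ->]]]]|[h1 h2]] //.
by exists c, u.
Qed.

Lemma mem_vertices_cell x : x \in vertices -> x.1.2 \in cells.
Proof.
rewrite mem_cat => /orP[/mapP[c h ->] //|/allpairsPdep[c [u [h _ ->]]]] //.
Qed.

Lemma uniq_vertices : (forall a, uniq (dom a)) -> uniq vertices.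
Proof.
move=> ud; rewrite cat_uniq; apply/and3P; split.
- by rewrite map_inj_uniq ?uniq_cells // => c c' [].
- by apply/hasPn => _ /allpairsPdep[c [u [_ _ ->]]]; apply/mapP => -[].
- by apply: allpairs_uniq_dep; [exact: uniq_cells | by move=> c _; exact: ud |]
  => -[c u] [c' u'] _ _ /= [-> ->].
Qed.

(** Rows of values come before columns of values. Inside each half every entry compares a value with
    a dummy and vanishes off the cell; across the halves, the entries above the diagonal compare two
    values and vanish because [u] is a solution. *)
Definition solution_chain (u : nat -> D) : seq (vtx * vtx) :=
  [seq (((false, c), u c.1), ((true, c), d0)) | c <- cells] ++
  [seq (((true, c), d0), ((false, c), u c.1)) | c <- cells].

Lemma solution_chainP u : solution u ->
  [/\ chain conflict (solution_chain u), uniq (unzip1 (solution_chain u)),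
      size (solution_chain u) = 2 * (m * L) &
      all (fun p => (p.1 \in vertices) && (p.2 \in vertices)) (solution_chain u)].
Proof.
move=> [ud uphi]; have inc c : c \in cells -> u c.1 \in dom c.1.
  by case: c => a l; rewrite mem_cells => /andP[/ud].
split.
- rewrite /chain all_cat !all_map pairwise_cat !pairwise_map allrel_mapl allrel_mapr.
  have neq : pairwise [rel c c' | c != c'] cells by rewrite -uniq_pairwise uniq_cells.
  apply/and4P; split.
  + by apply/andP; split; apply/allP => c _; rewrite /conflict /= eqxx.
  + apply/allrelP => -[a l] [b k]; rewrite !mem_cells => /andP[am _] /andP[bm _].
    by rewrite /conflict /= negbK uphi.
  + by apply: sub_pairwise neq => c c' /=; rewrite /conflict.
  + by apply: sub_pairwise neq => c c' /=; rewrite /conflict.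
- rewrite /unzip1 map_cat -!map_comp cat_uniq !map_inj_uniq ?uniq_cells //=; first last.
  + by move=> c c' [].
  + by move=> c c' [].
  by rewrite andbT; apply/hasPn => _ /mapP[c _ ->]; apply/mapP => -[].
- by rewrite size_cat !size_map size_cells; lia.
- have tr c : c \in cells -> ((true, c), d0) \in vertices.
    by move=> h; rewrite mem_cat map_f // => c' c'' [].
  rewrite all_cat !all_map; apply/andP; split; apply/allP => c h /=.
    by rewrite mem_vertices_real h inc //= tr.
  by rewrite mem_vertices_real h inc //= tr.
Qed.

Hypothesis phi_inj : forall a u v, a < m -> u \in dom a -> v \in dom a ->
  phi a a u = phi a a v -> u = v.

Let real (x : vtx) : bool := ~~ x.1.1.

Section ChainToSolution.
Variable s : seq (vtx * vtx).
Hypotheses (chain_s : chain conflict s)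
  (vs : all (fun p => (p.1 \in vertices) && (p.2 \in vertices)) s).

Let rr (p : vtx * vtx) : bool := real p.1 && real p.2.
Let key (p : vtx * vtx) : nat * nat := p.1.1.2.

Lemma key_cells p : p \in s -> (p.1.1.2 \in cells) && (p.2.1.2 \in cells).
Proof. by move=> /(allP vs)/andP[h1 h2]; rewrite !mem_vertices_cell. Qed.

(** The pairs are sorted by the variables of their row and column. Since copies do not matter in a
    conflict of values, each class obeys [chain_neq_le2], and the bound is independent of [L]. *)
Lemma size_real_real : size (filter rr s) <= 2 * (m * m).
Proof.
have -> : m * m = size [seq (a, b) | a <- iota 0 m, b <- iota 0 m].
  by rewrite size_allpairs !size_iota.
apply: (@size_le_keys _ _ (fun p => (p.1.1.2.1, p.2.1.2.1))).
  rewrite all_filter; apply/allP => p /key_cells/andP[h1 h2]; apply/implyP => _.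
  move: p.1.1.2 p.2.1.2 h1 h2 => [a l] [b k]; rewrite !mem_cells => /andP[am _] /andP[bm _].
  by apply/allpairsP; exists (a, b); rewrite !mem_iota.
move=> [a b] _; rewrite -size_filter.
apply: (@chain_neq_le2 _ _ (fun x : vtx => phi a b x.2) (fun y : vtx => phi b a y.2)).
rewrite -filter_predI; rewrite -(@sub_chain _ conflict); first exact: chain_filter.
move=> p q; rewrite !mem_filter /= /rr /real => /andP[/andP[/eqP[e1 e2] /andP[r1 r2]] _].
move=> /andP[/andP[/eqP[e3 e4] /andP[r3 r4]] _].
by rewrite /conflict (negbTE r1) (negbTE r4) /= e1 e4.
Qed.

(** All four entries lie in one cell. A dummy at [p.1] or at [q.2] would put a one above the
    diagonal, so both are values, and the dummies of the two pairs are [p.2] and [q.1]. *)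
Lemma chain_pair p q : chain conflict [:: p; q] -> ~~ rr p -> ~~ rr q -> key p = key q ->
  real p.1 && real q.2 && ~~ real p.2 && ~~ real q.1.
Proof.
rewrite /chain /= !andbT => /andP[/andP[cp cq] ncpq].
have side (p' : vtx * vtx) : conflict p'.1 p'.2 -> ~~ rr p' -> p'.2.1.2 = key p'.
  rewrite /conflict /rr /real negb_and !negbK => + h.
  by rewrite h => /eqP/esym.
move=> rp rq kpq; have k2 := side _ cp rp; have k4 := side _ cq rq.
have : real p.1 && real q.2.
  move: ncpq; rewrite /conflict /real k4 -kpq /key eqxx -negb_or.
  by case: (_ || _).
move=> /andP[r1 r2]; move: rp rq; rewrite /rr r1 r2 /= andbT => -> ->; exact: isT.
Qed.

(** Among three such pairs [p], [q], [r] of one cell, the row of [q] would be a dummy because of [p]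
    and a value because of [r]. *)
Lemma count_key_le2 c : count (fun p => key p == c) (filter (predC rr) s) <= 2.
Proof.
rewrite -size_filter -filter_predI.
have := chain_filter (predI (fun p => key p == c) (predC rr)) chain_s.
have : all (predI (fun p => key p == c) (predC rr))
  (filter (predI (fun p => key p == c) (predC rr)) s) by exact: filter_all.
case: (filter _ s) => [|p [|q [|r t]]] //=.
move=> /and4P[/andP[/eqP kp rp] /andP[/eqP kq rq] /andP[/eqP kr rr'] _].
rewrite /chain /= => /andP[/and4P[cp cq cr _] /and3P[/and3P[npq _ _] /andP[nqr _] _]].
have := @chain_pair p q; rewrite /chain /= cp cq npq => /(_ isT rp rq).
rewrite kp kq => /(_ erefl)/andP[_ h].
have := @chain_pair q r; rewrite /chain /= cq cr nqr => /(_ isT rq rr').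
by rewrite kq kr => /(_ erefl); rewrite (negbTE h).
Qed.

Hypotheses (L_large : 2 * (m * m) + 2 <= L) (s_large : 2 * (m * L) <= (size s).+1).

(** Otherwise [s] has at most [2 * (m * m)] pairs of values, [L] pairs with a dummy at the variable
    [a] and [2 * (m.-1 * L)] at the others. By [L_large] this is at most [2 * (m * L) - 2], one less
    than [s_large] permits. *)
Lemma full_cell a : a < m ->
  exists l, 2 <= count (fun p => key p == (a, l)) (filter (predC rr) s).
Proof.
move=> am; pose t := filter (predC rr) s.
have [/hasP[l _ h]|/hasPn h] := boolP (has (fun l => 2 <= count (fun p => key p == (a, l)) t) (iota 0 L)).
  by exists l.
have keyt : all (fun p => key p \in cells) t.
  by rewrite all_filter; apply/allP => p /key_cells/andP[h1 _]; apply/implyP.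
have s1 : size (filter (fun p => (key p).1 == a) t) <= 1 * size [seq (a, l) | l <- iota 0 L].
  apply: (@size_le_keys _ _ key).
    rewrite all_filter; apply: sub_all keyt => p /=; case: (key p) => b k /=.
    rewrite mem_cells => /andP[_ kL]; apply/implyP => /eqP ->.
    by apply: map_f; rewrite mem_iota.
  move=> _ /mapP[l lL ->]; have := h l lL; rewrite -ltnNge ltnS => h1.
  apply: leq_trans h1; rewrite count_filter; apply: sub_count => p /= /andP[] //.
have s2 : size (filter (fun p => (key p).1 != a) t) <=
    2 * size [seq (b, l) | b <- rem a (iota 0 m), l <- iota 0 L].
  apply: (@size_le_keys _ _ key).
    rewrite all_filter; apply: sub_all keyt => p /=; case: (key p) => b k /=.
    rewrite mem_cells => /andP[bm kL]; apply/implyP => ba.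
    by apply/allpairsP; exists (b, k); rewrite mem_rem_uniq ?iota_uniq // !inE !mem_iota ba.
  move=> c _; apply: leq_trans (count_key_le2 c).
  by rewrite -/t count_filter; apply: sub_count => p /= /andP[].
have := count_predC rr s; rewrite -!size_filter -/t.
have := count_predC (fun p => (key p).1 == a) t; rewrite -!size_filter.
move: s1 s2; rewrite size_allpairs size_map size_rem ?mem_iota // !size_iota.
have -> : filter (predC (fun p => (key p).1 == a)) t = filter (fun p => (key p).1 != a) t by [].
have := size_real_real; rewrite mul1n.
have em : m * L = m.-1 * L + L by rewrite -{1}(prednK (leq_ltn_trans (leq0n _) am)) mulSn addnC.
move: s_large L_large; rewrite em; lia.
Qed.

Lemma chain_solution : exists u, solution u.
Proof.
pose P a (x : D * (nat * nat)) := let: (u, (i, j)) := x in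
  [/\ u \in dom a, i < j < size s,
    real (nth (((true, (0, 0)), d0), ((true, (0, 0)), d0)) s i).1 &
    [/\ (nth (((true, (0, 0)), d0), ((true, (0, 0)), d0)) s i).1.1.2.1 = a,
        (nth (((true, (0, 0)), d0), ((true, (0, 0)), d0)) s i).1.2 = u,
        real (nth (((true, (0, 0)), d0), ((true, (0, 0)), d0)) s j).2,
        (nth (((true, (0, 0)), d0), ((true, (0, 0)), d0)) s j).2.1.2.1 = a &
        (nth (((true, (0, 0)), d0), ((true, (0, 0)), d0)) s j).2.2 = u]].
set x0 := (((true, (0, 0)), d0), ((true, (0, 0)), d0)) in P.
have [f hf] : exists f, forall a, a < m -> P a (f a).
  apply: (finite_choice (d0, (0, 0))) => a am; have [l] := full_cell am.
  rewrite -size_filter -filter_predI.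
  have ch := chain_filter (predI (fun p => key p == (a, l)) (predC rr)) chain_s.
  have al : all (predI (fun p => key p == (a, l)) (predC rr))
    (filter (predI (fun p => key p == (a, l)) (predC rr)) s) by exact: filter_all.
  case e : (filter _ s) ch al => [|p [|q t]] //.
  rewrite /chain /= => /andP[/and3P[cp cq _] /andP[/andP[npq _] _]].
  move=> /and3P[/andP[/eqP kp rp] /andP[/eqP kq rq] _] _.
  have := @chain_pair p q; rewrite /chain /= cp cq npq => /(_ isT rp rq).
  rewrite kp kq => /(_ erefl)/andP[/andP[/andP[r1 r2] r3] r4].
  have [i [j [ij ni nj]]] := filter_cons2_nth x0 e.
  have ps : p \in s by rewrite -ni mem_nth //; lia.
  have qs : q \in s by rewrite -nj mem_nth //; lia.
  have kq2 : q.2.1.2 = (a, l).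
    by move: cq; rewrite /conflict; move: r4; rewrite /real negbK => -> /= /eqP <-.
  have dp : p.1.2 \in dom a.
    have /andP[+ _] := allP vs _ ps; move: r1 kp; rewrite /real /key.
    by case: (p.1) => [[[] c] u] //= _ ->; rewrite mem_vertices_real => /andP[].
  have dq : q.2.2 \in dom a.
    have /andP[_ +] := allP vs _ qs; move: r2 kq2; rewrite /real.
    by case: (q.2) => [[[] c] u] //= _ ->; rewrite mem_vertices_real => /andP[].
  exists (p.1.2, (i, j)); rewrite /P ni nj; split=> //; split=> //.
  - by move: kp; rewrite /key => ->.
  - by rewrite kq2.
  (* The entry at the row [p.1] and the column [q.2] is zero, and agreeing values of one variable
     are equal. *)
  - apply: (@phi_inj a) => //; move: npq; rewrite /conflict.
    move: r1 r2; rewrite /real => /negbTE-> /negbTE-> /=.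
    by move: kp; rewrite /key => ->; rewrite kq2 negbK => /eqP.
exists (fun a => (f a).1); split=> [a /hf|a b /hf + /hf].
  by rewrite /P; case: (f a) => u [i j] [].
rewrite /P; case: (f a) (f b) => u [i j] [v [i' j']] /=.
move=> [_ ij r1 [a1 u1 r2 a2 u2]] [_ ij' r1' [b1 v1 r2' b2 v2]].
have /andP[_ /(pairwiseP x0) h] := chain_s.
have [/andP[lij js] /andP[lij' js']] := (ij, ij').
have [si si'] := (ltn_trans lij js, ltn_trans lij' js').
have [ij2|ji] := ltnP i j'.
  have := h i j' si js' ij2.
  rewrite /conflict; move: r1 r2'; rewrite /real => /negbTE-> /negbTE-> /=.
  by rewrite negbK a1 b2 u1 v2 => /eqP.
(* Here [i' < j' <= i < j], so the zero is at the row of [b] and the column of [a]. *)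
have := h i' j si' js (ltn_trans lij' (leq_ltn_trans ji lij)).
rewrite /conflict; move: r1' r2; rewrite /real => /negbTE-> /negbTE-> /=.
by rewrite negbK b1 a2 v1 u2 => /eqP.
Qed.

End ChainToSolution.
End Gadget.

(* Two copies of [V], joined along [r]; the copy [true] is made a clique when
   [sp] holds. *)
Section DoubleGraph.
Variables (T : eqType) (r : rel T) (sp : bool).
Hypothesis r_sym : symmetric r.

Definition double_rel (p q : bool * T) : bool :=
  if p.1 == q.1 then [&& sp, p.1 & p.2 != q.2] else r p.2 q.2.

Definition double (V : seq T) : seq (bool * T) := [seq (b, x) | b <- [:: false; true], x <- V].

Definition double_matrix (V : seq T) : seq (seq bool) :=
  [seq [seq double_rel p q | q <- double V] | p <- double V].

Variable V : seq T.

Let lab (u : 'I_(size (double V))) : bool * T := tnth (in_tuple (double V)) u.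

Lemma double_rel_sym : symmetric double_rel.
Proof.
move=> p q; rewrite /double_rel eq_sym; case: eqP => [->|_]; last exact: r_sym.
by rewrite [in RHS]eq_sym.
Qed.

Lemma double_rel_irr : irreflexive double_rel.
Proof. by move=> p; rewrite /double_rel !eqxx /= !andbF. Qed.

Lemma mem_double b x : ((b, x) \in double V) = (x \in V).
Proof.
apply/allpairsP/idP => [[[c y] /= [_ h [_ ->]]] //|h].
by exists (b, x); split=> //; case: b.
Qed.

Lemma double_graph_sym : symmetric (fun u v => double_rel (lab u) (lab v)).
Proof. by move=> u v; exact: double_rel_sym. Qed.

Lemma double_graph_irr : irreflexive (fun u v => double_rel (lab u) (lab v)).
Proof. by move=> u; exact: double_rel_irr. Qed.

Definition double_graph : sgraph := SGraph double_graph_sym double_graph_irr.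

Lemma map_lab (U : Type) (f : bool * T -> U) :
  [seq f (lab u) | u <- enum 'I_(size (double V))] = [seq f p | p <- double V].
Proof. by rewrite (map_comp f lab) [map lab _](map_tnth_enum (in_tuple (double V))). Qed.

Lemma double_graphE : adj_matrix double_graph = double_matrix V.
Proof.
rewrite /adj_matrix /double_matrix /= -map_lab.
by apply: eq_map => u; rewrite -map_lab.
Qed.

Lemma double_graph_bipartite : sp = false -> bipartite double_graph.
Proof.
move=> spF; exists [set u | (lab u).1] => u v; rewrite !inE /= /double_rel spF.
by case: (lab u) (lab v) => [[] x] [[] y].
Qed.

Lemma double_graph_split : uniq V -> sp -> split_graph double_graph.
Proof.
move=> uV spT; exists [set u | (lab u).1]; split=> u v; rewrite !inE /= /double_rel.
  move=> hu hv uv; rewrite spT hu hv /=; apply: contra_neq uv => e.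
  have ud : uniq (double V).
    by apply: allpairs_uniq => //; move=> [b x] [c y] _ _ [-> ->].
  apply/val_inj/eqP; rewrite -(nth_uniq (false, (lab u).2) _ _ ud) ?ltn_ord //.
  have tn w : nth (false, (lab u).2) (double V) (val w) = lab w.
    by rewrite [RHS](tnth_nth (false, (lab u).2)).
  rewrite !tn; apply/eqP; move: hu hv e.
  by case: (lab u) (lab v) => [b x] [c y] /= -> -> ->.
by move=> /negbTE-> /negbTE->; rewrite eqxx andbF.
Qed.

Lemma pull_lab (t : seq ((bool * T) * (bool * T))) :
  all (fun p => (p.1 \in double V) && (p.2 \in double V)) t ->
  exists t', t = [seq (lab p.1, lab p.2) | p <- t'].
Proof.
elim: t => [|[p q] t IH] /=; first by exists [::].
move=> /andP[/andP[/(@tnthP _ _ (in_tuple _))[i ->] /(@tnthP _ _ (in_tuple _))[j ->]] /IH[t' ->]].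
by exists ((i, j) :: t').
Qed.

(** [s] is used in both directions, with the rows in the copy [false] first. The entries above the
    diagonal between the two halves then lie inside the copy [false], which is independent for both
    values of [sp]. *)
Lemma double_graph_tds s : chain r s -> uniq (unzip1 s) ->
  all (fun p => (p.1 \in V) && (p.2 \in V)) s ->
  exists v : (2 * size s).-tuple 'I_(order double_graph), total_dominating_sequence v.
Proof.
move=> cs us vs.
pose t := [seq ((false, p.1), (true, p.2)) | p <- s] ++ [seq ((true, p.1), (false, p.2)) | p <- s].
have ct : chain double_rel t.
  case/andP: cs => h1 h2; rewrite /chain all_cat pairwise_cat !all_map !pairwise_map.
  rewrite allrel_mapl allrel_mapr /double_rel /= h1 h2 !andbT.
  by apply/allrelP => p q _ _; rewrite /= andbF.
have ut : uniq (unzip1 t).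
  rewrite /unzip1 map_cat -!map_comp (map_comp (pair false) fst) (map_comp (pair true) fst).
  have [inj0 inj1] : injective (pair (A := bool) (B := T) false) /\ injective (pair (A := bool) (B := T) true).
    by split=> x y [].
  rewrite cat_uniq (map_inj_uniq inj0) (map_inj_uniq inj1) us andbT /=.
  by apply/hasPn => _ /mapP[x _ ->]; apply/mapP => -[].
have vt : all (fun p => (p.1 \in double V) && (p.2 \in double V)) t.
  by rewrite all_cat !all_map; apply/andP; split; apply: sub_all vs => p; rewrite /= !mem_double.
have [t' et] := pull_lab vt.
have st : size t' = 2 * size s.
  by rewrite -(size_map (fun p => (lab p.1, lab p.2)) t') -et size_cat !size_map; lia.
rewrite -st; apply: (@tds_of_chain double_graph t').
  by move: ct; rewrite et (chain_map (r := @adj double_graph)).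
by move: ut; rewrite et /unzip1 -map_comp (map_comp lab fst); apply: map_uniq.
Qed.

(** A pair inside one copy lies in the clique, where adjacency is an inequality, so there are at
    most 2 of these. The other pairs split into two classes by direction, and the larger class gives
    [s]. Only the matrix of [G] is known, so its vertices are first identified with those of
    [double_graph]. *)
Lemma double_graph_chain (G : sgraph) l (v : l.-tuple 'I_(order G)) :
  adj_matrix G = double_matrix V -> total_dominating_sequence v ->
  exists s, [/\ chain r s, all (fun p => (p.1 \in V) && (p.2 \in V)) s & l <= 2 * size s + 2].
Proof.
rewrite -double_graphE => /(congr1 (enc_seq (enc_seq enc_bool)))/enc_graph_inj[eq_n eq_adj].
move=> /chain_of_tds[s0 <- c0].
pose f u := lab (cast_ord eq_n u).
have c1 : chain double_rel [seq (f p.1, f p.2) | p <- s0] by rewrite (chain_map (r := @adj G)).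
have fV u : (f u).2 \in V.
  by have := mem_tnth (cast_ord eq_n u) (in_tuple (double V)); rewrite -/(lab _) -/(f u);
  case: (f u) => b x; rewrite mem_double.
have : all (fun p => (p.1.2 \in V) && (p.2.2 \in V)) [seq (f p.1, f p.2) | p <- s0].
  by rewrite all_map; apply/allP => p _ /=; rewrite !fV.
rewrite -(size_map (fun p => (f p.1, f p.2))); move: {s0 c0} [seq _ | p <- s0] c1 => s c1 vs.
pose side b := filter (fun p => (p.1.1 == b) && (p.2.1 == ~~ b)) s.
pose proj (t : seq ((bool * T) * (bool * T))) := [seq (p.1.2, p.2.2) | p <- t].
have cside b : chain r (proj (side b)).
  have := chain_filter (fun p => (p.1.1 == b) && (p.2.1 == ~~ b)) c1.
  rewrite (@sub_chain _ _ (fun x y => r x.2 y.2)).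
    by rewrite -/(side b) -(@chain_map _ _ _ r snd).
  move=> p q; rewrite !mem_filter => /andP[/andP[/eqP e1 _] _] /andP[/andP[_ /eqP e2] _].
  by rewrite /double_rel e1 e2; case: (b).
have vside b : all (fun p => (p.1 \in V) && (p.2 \in V)) (proj (side b)).
  rewrite /proj all_map; apply/allP => p; rewrite mem_filter => /andP[_ ps].
  exact: (allP vs _ ps).
have c2 : size (filter (fun p => p.1.1 == p.2.1) s) <= 2.
  apply: (@chain_neq_le2 _ _ snd snd).
  have al : all (fun p => sp && p.1.1 && p.2.1) (filter (fun p => p.1.1 == p.2.1) s).
    rewrite all_filter; case/andP: c1 => + _; apply: sub_all => p /=.
    rewrite /double_rel; case: eqP => //= e /and3P[-> h _]; by rewrite -e h.
  rewrite -(@sub_chain _ double_rel); first exact: chain_filter.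
  move=> p q /(allP al)/andP[/andP[h1 h2] _] /(allP al)/andP[_ h3].
  by rewrite /double_rel h2 h3 h1.
have sz : size s = size (side true) + size (side false) + size (filter (fun p => p.1.1 == p.2.1) s).
  rewrite /side !size_filter; elim: (s) => //= -[[b x] [c y]] t ->.
  by move: (count _ t) (count _ t) (count _ t) => i j k; case: b; case: c => /=; lia.
have [le|le] := leqP (size (side false)) (size (side true)).
  by exists (proj (side true)); split=> //; rewrite size_map sz; move: le c2;
    move: (size (side _)) (size (side _)) (size (filter _ _)) => i j k; lia.
by exists (proj (side false)); split=> //; rewrite size_map sz; move: le c2;
    move: (size (side _)) (size (side _)) (size (filter _ _)) => i j k; lia.
Qed.

End DoubleGraph.

(** * Circuits of weft 1 as polynomials *)

Section LowDegree.
Local Open Scope ring_scope.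
Implicit Types F G : seq nat -> int.

(* [F], as a function of a set given by an enumeration, is a polynomial of
   degree at most [q] in the indicator variables. *)
Fixpoint lowdeg (q : nat) F : Prop :=
  match q with
  | 0 => forall U V, F U = F V
  | q'.+1 => forall x, lowdeg q' (fun U => F (x :: U) - F U)
  end.

Lemma lowdeg_ext q F G : F =1 G -> lowdeg q F -> lowdeg q G.
Proof.
elim: q F G => [|q IH] F G FG /= h; first by move=> U V; rewrite -!FG.
by move=> x; apply: IH (h x) => U; rewrite !FG.
Qed.

Lemma lowdeg_const q c : lowdeg q (fun=> c).
Proof.
by elim: q c => //= q IH c x; exact: IH.
Qed.

Lemma lowdegW q p F : (q <= p)%N -> lowdeg q F -> lowdeg p F.
Proof.
elim: q p F => [|q IH] [|p] //= F; last by move=> qp h x; exact: IH.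
by move=> _ h x; apply: lowdeg_ext (lowdeg_const p 0) => U; rewrite (h (x :: U) U) subrr.
Qed.

Lemma lowdegD q F G : lowdeg q F -> lowdeg q G -> lowdeg q (fun U => F U + G U).
Proof.
elim: q F G => [|q IH] F G /= hF hG; first by move=> U V; rewrite (hF U V) (hG U V).
by move=> x; apply: lowdeg_ext (IH _ _ (hF x) (hG x)) => U; ring.
Qed.

Lemma lowdegZ q c F : lowdeg q F -> lowdeg q (fun U => c * F U).
Proof.
elim: q F => [|q IH] F /= hF; first by move=> U V; rewrite (hF U V).
by move=> x; apply: lowdeg_ext (IH _ (hF x)) => U; ring.
Qed.

(** Induction on [p + q] with the product rule for differences: the difference of [F * G] is
    [DF * G + F * DG + DF * DG], where [DF] and [DG] have lower degree. *)
Lemma lowdegM p q F G : lowdeg p F -> lowdeg q G -> lowdeg (p + q) (fun U => F U * G U).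
Proof.
move: {2}(p + q)%N (leqnn (p + q)) => n; elim: n p q F G => [|n IH] [|p] [|q] F G //= le hF hG.
- by move=> U V; rewrite (hF U V) (hG U V).
- by move=> U V; rewrite (hF U V) (hG U V).
- apply: (@lowdeg_ext q.+1 (fun U => F [::] * G U)).
    by move=> U; rewrite (hF U [::]).
  exact: (@lowdegZ q.+1).
- rewrite addn0; apply: (@lowdeg_ext p.+1 (fun U => G [::] * F U)).
    by move=> U; rewrite (hG U [::]) mulrC.
  exact: (@lowdegZ p.+1).
- move=> x.
  apply: (lowdeg_ext (F := fun U => (F (x :: U) - F U) * G U +
    (F U * (G (x :: U) - G U) + (F (x :: U) - F U) * (G (x :: U) - G U)))).
    by move=> U; ring.
  apply: lowdegD; first by apply: (IH p q.+1) => //; lia.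
  apply: lowdegD.
    by apply: lowdegW (IH p.+1 q _ _ _ hF (hG x)); lia.
  by apply: lowdegW (IH p q _ _ _ (hF x) (hG x)); lia.
Qed.

Lemma lowdeg_count_mem i : lowdeg 1 (fun U => (count_mem i U)%:Z).
Proof. by move=> x U V /=; rewrite !PoszD; ring. Qed.

End LowDegree.

Definition word_step (ws : seq (seq nat)) : seq (seq nat) :=
  [seq 0 :: w | w <- ws] ++ ([seq 1 :: w | w <- ws] ++ [seq 2 :: w | w <- ws]).

(* All words of length [k] over [{0, 1, 2}]. A word codes a pair of sets [J] and
   [I] with [J] contained in [I]: the positions of the letter 2, and those of the
   letters 1 and 2. *)
Definition words (k : nat) : seq (seq nat) := iter k word_step [:: [::]].

(** In the coding by words this is the size of [I]; [twos] is the indicator of [J], and the letters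
    1 mark the rest of [I], whose size gives the sign. *)
Definition nonzeros (w : seq nat) : nat := count (fun c => c != 0) w.

Definition twos (w : seq nat) : bitseq := [seq c == 2 | c <- w].

Lemma mem_words k w : (w \in words k) = (size w == k) && all (fun c => c < 3) w.
Proof.
elim: k w => [|k IH] w; first by rewrite inE; case: w.
rewrite /words iterS /word_step !mem_cat.
case: w => [|c w] /=.
  by apply/negbTE; rewrite !negb_or; apply/and3P; split; apply/mapP => -[].
have mm d : (c :: w \in [seq d :: w | w <- words k]) = (c == d) && (w \in words k).
  apply/mapP/andP => [[v h [-> ->]] //|[/eqP -> h]]; by exists w.
rewrite !mm IH eqSS; case: (size w == k); case: (all _ w); rewrite ?andbF ?andbT ?orbF //.
by case: c {mm} => [|[|[|c]]].
Qed.

Lemma uniq_words k : uniq (words k).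
Proof.
elim: k => // k IH; rewrite /words iterS /word_step.
have inj d : injective (cons (d : nat)) by move=> u v [].
rewrite !cat_uniq !map_inj_uniq // IH /= has_cat negb_or !andbT.
by apply/andP; split; [apply/andP; split|]; apply/hasPn => _ /mapP[w _ ->]; apply/mapP => -[].
Qed.

Lemma size_words k : size (words k) = 3 ^ k.
Proof.
elim: k => // k IH; rewrite /words iterS /word_step !size_cat !size_map IH expnS; lia.
Qed.

(* Inclusion-exclusion over the pairs of sets [J] contained in [I]; the terms
   with [#|I| > q] cancel for a polynomial of degree [q]. *)
Lemma lowdeg_interpolation q F (s : seq nat) : lowdeg q F ->
  (\sum_(w <- words (size s) | (nonzeros w <= q)%N)
     (-1) ^+ count_mem 1%N w * F (mask (twos w) s) = F s)%R.
Proof.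
elim: s q F => [|x s IH] q F hF.
  by rewrite big_mkcond big_seq1 /= expr0 mul1r.
rewrite [words _]/(word_step (words (size s))) /word_step !big_cat !big_map /=.
rewrite (eq_bigl (fun w => nonzeros w <= q)) // IH //.
case: q hF => [|q] hF.
  by rewrite !big_pred0 ?addr0 ?(hF s (x :: s)).
(* The first letters 1 and 2 have opposite signs and combine to the difference of [F] at [x], to
   which the induction hypothesis applies with one nonzero letter less. *)
rewrite -big_split /=.
rewrite (eq_bigr (fun w => (-1) ^+ count_mem 1%N w *
    (F (x :: mask (twos w) s) - F (mask (twos w) s)))%R); last first.
  by move=> w _; rewrite exprS add0n; ring.
rewrite (eq_bigl (fun w => nonzeros w <= q)) //.
by rewrite (IH q (fun U => F (x :: U) - F U)%R (hF x)); ring.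
Qed.

Lemma digit_pair b x y : x < b -> (x + b * y) %% b = x /\ (x + b * y) %/ b = y.
Proof.
move=> xb; rewrite [b * y]mulnC addnC modnMDl modn_small // divnMDl; last lia.
by rewrite divn_small // addn0.
Qed.

Lemma pair_bound b x y : x < b -> y < b -> x + b * y < b * b.
Proof. nia. Qed.

(** * Gate values packed into numbers, and their degree *)

Section Circuits.

Definition gate_values (a : nat -> bool) (C : circuit) : seq bool :=
  foldl (fun vs g => rcons vs (gate_value a vs g)) [::] C.

Lemma gate_values_rcons a C g :
  gate_values a (rcons C g) = rcons (gate_values a C) (gate_value a (gate_values a C) g).
Proof. by rewrite /gate_values foldl_rcons. Qed.

Lemma size_gate_values a C : size (gate_values a C) = size C.
Proof. by elim/last_ind: C => // C g IH; rewrite gate_values_rcons !size_rcons IH. Qed.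

Lemma nth_gate_values a C i : i < size C ->
  nth false (gate_values a C) i = gate_value a (take i (gate_values a C)) (gate_at C i).
Proof.
elim/last_ind: C => // C g IH; rewrite size_rcons ltnS leq_eqVlt gate_values_rcons.
rewrite nth_rcons size_gate_values /gate_at nth_rcons -cats1 take_cat size_gate_values.
move=> /orP[/eqP ->|lt]; last by rewrite lt IH.
by rewrite ltnn eqxx subnn /= cats0.
Qed.

Variable C : circuit.
Hypothesis wfC : circuit_wf C.

Lemma gate_argsP i j : i < size C -> j \in gate_args (gate_at C i) -> j < i.
Proof. by move=> iC ji; have [_ /(_ i iC)[_ /allP]] := wfC; apply. Qed.

Lemma nth_gate_valuesE a i : i < size C ->
  nth false (gate_values a C) i = let v := nth false (gate_values a C) in
    match gate_at C i with
    | GInput => a i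
    | GNot j => ~~ v j
    | GAnd l => all v l
    | GOr l => has v l
    end.
Proof.
move=> iC; rewrite nth_gate_values //.
have tk j : j \in gate_args (gate_at C i) ->
    nth false (take i (gate_values a C)) j = nth false (gate_values a C) j.
  by move=> /(gate_argsP iC) ji; rewrite nth_take.
case: (gate_at C i) tk => [_|j tk|l tk|l tk] /=.
- by rewrite size_takel // size_gate_values ltnW.
- by rewrite tk // mem_head.
- exact: eq_in_all.
- exact: eq_in_has.
Qed.

Lemma eq_gate_values a b : {in input_nodes C, a =1 b} -> gate_values a C = gate_values b C.
Proof.
move=> ab; apply: (@eq_from_nth _ false); rewrite !size_gate_values // => i.
have [n] := ubnP i; elim: n i => // n IH i /ltnSE ltn iC.
have IHa j : j \in gate_args (gate_at C i) ->
    nth false (gate_values a C) j = nth false (gate_values b C) j.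
  by move=> /(gate_argsP iC) ji; apply: IH; lia.
rewrite !nth_gate_valuesE //=; case e: (gate_at C i) IHa => [|j|l|l] IHa.
- by apply: ab; rewrite mem_filter mem_iota e /= iC.
- by rewrite IHa // mem_head.
- exact: eq_in_all.
- exact: eq_in_has.
Qed.

(* Two gates [i] and [j] below a binary gate are packed into the two digits of
   a number; a gate of large indegree is represented by the number of its true
   arguments. *)
Fixpoint base (t : nat) (D : circuit) : nat :=
  if t is t'.+1 then base t' D * base t' D else (size D).+1.

Fixpoint digits (t : nat) (D : circuit) (vs : seq bool) (i : nat) : nat :=
  let l := gate_args (nth GInput D i) in
  let v := if nth false vs i then 1 else 0 in
  match t with
  | 0 => v
  | t'.+1 =>
    if 2 < size l then count (fun j => nth false vs j) l
    else if size l == 2 then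
      digits t' D vs (nth 0 l 0) + base t' D * digits t' D vs (nth 0 l 1)
    else if size l == 1 then digits t' D vs (nth 0 l 0) else v
  end.

Definition is_and (g : gate) : bool := if g is GAnd _ then true else false.

(** [digits] only collects numbers; the logic is applied here. A gate with one argument is a
    not-gate, since and- and or-gates have at least two. *)
Fixpoint decode (t : nat) (D : circuit) (i x : nat) : bool :=
  let l := gate_args (nth GInput D i) in
  let c := is_and (nth GInput D i) in
  match t with
  | 0 => x != 0
  | t'.+1 =>
    if 2 < size l then if c then x == size l else x != 0
    else if size l == 2 then
      if c then decode t' D (nth 0 l 0) (x %% base t' D) && decode t' D (nth 0 l 1) (x %/ base t' D)
      else decode t' D (nth 0 l 0) (x %% base t' D) || decode t' D (nth 0 l 1) (x %/ base t' D)
    else if size l == 1 then ~~ decode t' D (nth 0 l 0) x else x != 0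
  end.

Lemma base_ge t : size C < base t C.
Proof. elim: t => //= t IH; have b0 := leq_ltn_trans (leq0n _) IH.
by apply: leq_trans IH _; rewrite leq_pmulr. Qed.

Lemma size_gate_args i : i < size C -> size (gate_args (gate_at C i)) <= size C.
Proof.
move=> iC; have [_ /(_ i iC)[ok _]] := wfC.
have ul : uniq (gate_args (gate_at C i)) by case: (gate_at C i) ok => //= l /andP[].
rewrite -[size C](size_iota 0) uniq_leq_size // => j /(gate_argsP iC) ji.
by rewrite mem_iota /=; lia.
Qed.

(** This holds at every level [t], because at level 0 the number is the value of the gate itself;
    depth matters for the degree alone. A base above [size C] leaves room for a count of arguments,
    and its square for two digits. *)
Lemma digitsP a t i : i < size C ->
  digits t C (gate_values a C) i < base t C /\
  decode t C i (digits t C (gate_values a C) i) = nth false (gate_values a C) i.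
Proof.
set vs := gate_values a C.
have b1 t' : 1 < base t' C.
  by have := base_ge t'; have [+ _] := wfC; lia.
have bit (b : bool) : ((if b then 1 else 0) != 0) = b by case: b.
elim: t i => [|t IH] i iC /=.
  by rewrite bit; split=> //; have := b1 0 => /=; case: ifP; lia.
have B0 : base t C < base t C * base t C by rewrite -[X in X < _]muln1 ltn_mul2l b1; have := b1 t; lia.
have le := size_gate_args iC; have [_ /(_ i iC)[ok _]] := wfC.
have vE := nth_gate_valuesE a iC; rewrite -/vs /= in vE; rewrite vE.
have lt j : j \in gate_args (gate_at C i) -> j < size C.
  by move=> /(gate_argsP iC) ji; lia.
rewrite -/(gate_at C i); case: ifP => [lg|/negbT]; last rewrite -leqNgt => sm.
  split; first by have := count_size (fun j => nth false vs j) (gate_args (gate_at C i)); have := base_ge t; lia.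
  case: (gate_at C i) ok lg {vE lt le} => //= l _ _; first by rewrite -all_count.
  by rewrite -lt0n -has_count.
case: (gate_at C i) ok sm {vE le} lt => [_|j _|l /andP[_ l2]|l /andP[_ l2]] /= sm lt.
- rewrite bit; split=> //; apply: leq_ltn_trans _ B0.
  by case: ifP => _; have := b1 t; lia.
- have [h1 h2] := IH j (lt j (mem_head _ _)).
  by rewrite h2; split=> //; exact: ltn_trans h1 B0.
- have sl : size l = 2 by lia.
  case: l sl l2 sm lt => [|x [|y []]] //= _ _ _ lt.
  have [h1 h2] := IH x (lt x (mem_head _ _)).
  have [h3 h4] := IH y (lt y ltac:(by rewrite !inE eqxx orbT)).
  have [e1 e2] := digit_pair (digits t C vs y) h1.
  by rewrite e1 e2 h2 h4 andbT; split=> //; exact: pair_bound.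
- have sl : size l = 2 by lia.
  case: l sl l2 sm lt => [|x [|y []]] //= _ _ _ lt.
  have [h1 h2] := IH x (lt x (mem_head _ _)).
  have [h3 h4] := IH y (lt y ltac:(by rewrite !inE eqxx orbT)).
  have [e1 e2] := digit_pair (digits t C vs y) h1.
  by rewrite e1 e2 h2 h4 orbF; split=> //; exact: pair_bound.
Qed.

(** The bounds on paths to the output are localized at a gate [i], so that they can be handed down
    to its arguments. *)
Definition depth_at (t i : nat) : Prop := forall u p,
  u < size C -> is_input (gate_at C u) -> path (wire C) u p -> last u p = i -> size p <= t.

Definition weft_at (c i : nat) : Prop := forall u p,
  u < size C -> is_input (gate_at C u) -> path (wire C) u p -> last u p = i ->
  count (large C) (u :: p) <= c.

(** A gate other than an input has an argument, at a smaller position, so a descent ends at an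
    input. Thus bounds on paths from inputs constrain every gate. *)
Lemma reachable i : i < size C -> exists u p,
  [/\ u < size C, is_input (gate_at C u), path (wire C) u p & last u p = i].
Proof.
have [n] := ubnP i; elim: n i => // n IH i /ltnSE ltn iC.
case: (boolP (is_input (gate_at C i))) => [inp|ninp]; first by exists i, [::].
have [j ji] : exists j, j \in gate_args (gate_at C i).
  have [_ /(_ i iC)[ok _]] := wfC.
  case: (gate_at C i) ok ninp => //= [j _ _|l /andP[_ l2] _|l /andP[_ l2] _].
  - by exists j; rewrite mem_head.
  - by case: l l2 => // j l; exists j; rewrite mem_head.
  - by case: l l2 => // j l; exists j; rewrite mem_head.
have lt := gate_argsP iC ji.
have [u [p [uC up pth la]]] := IH j ltac:(lia) (ltn_trans lt iC).
by exists u, (rcons p i); split=> //; rewrite ?last_rcons // rcons_path pth la.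
Qed.

Lemma depth_at_arg t i j : depth_at t.+1 i -> j \in gate_args (gate_at C i) -> depth_at t j.
Proof.
move=> h ji u p uC up pth la; have := h u (rcons p i) uC up.
by rewrite size_rcons last_rcons rcons_path pth la => /(_ ji erefl).
Qed.

Lemma weft_at_arg c i j : weft_at c i -> j \in gate_args (gate_at C i) ->
  weft_at (c - large C i) j.
Proof.
move=> h ji u p uC up pth la; have := h u (rcons p i) uC up.
rewrite last_rcons rcons_path pth la -rcons_cons -cats1 count_cat /= addn0.
by move=> /(_ ji erefl); lia.
Qed.

Lemma depth_at0 i : i < size C -> depth_at 0 i -> is_input (gate_at C i).
Proof.
move=> /reachable[u [p [uC up pth la]]] /(_ u p uC up pth la).
by case: p pth la => //= _ <-.
Qed.

Let val (U : seq nat) (i : nat) : bool := nth false (gate_values (mem U) C) i.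

(** The difference of [count_mem i] is constant on all lists, which fails for membership; the two
    agree on lists without repetition. *)
Lemma lowdeg_input t i : i < size C -> is_input (gate_at C i) ->
  exists2 P, lowdeg (2 ^ t) P & forall U, uniq U -> P U = Posz (val U i).
Proof.
move=> iC inp; exists (fun U => Posz (count_mem i U)).
  by apply: lowdegW (lowdeg_count_mem i); rewrite expn_gt0.
move=> U uU; rewrite /val nth_gate_valuesE //.
by case: (gate_at C i) inp => //= _; rewrite count_uniq_mem.
Qed.

(** Without large gates each gate is a polynomial in at most two values. Multiplying them at most
    doubles the degree, once per level. *)
Lemma lowdeg_small t i : i < size C -> depth_at t i -> weft_at 0 i ->
  exists2 P, lowdeg (2 ^ t) P & forall U, uniq U -> P U = Posz (val U i).
Proof.
elim: t i => [|t IH] i iC; first by move=> /(depth_at0 iC) inp _; exact: lowdeg_input.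
move=> di wi.
have sm : size (gate_args (gate_at C i)) <= 2.
  have [u [p [uC up pth la]]] := reachable iC; have := wi u p uC up pth la.
  move=> h0; rewrite leqNgt; apply: contraL h0 => lg; rewrite -ltnNge -has_count.
  by apply/hasP; exists i => //; rewrite -la mem_last.
have IHj j : j \in gate_args (gate_at C i) ->
    exists2 P, lowdeg (2 ^ t) P & forall U, uniq U -> P U = Posz (val U j).
  move=> ji; apply: IH; first exact: ltn_trans (gate_argsP iC ji) iC.
    exact: depth_at_arg di ji.
  by move=> u p uC up pth la; exact: leq_trans (weft_at_arg wi ji uC up pth la) _.
have vE U := nth_gate_valuesE (mem U) iC.
have [_ /(_ i iC)[ok _]] := wfC.
have e2 : 2 ^ t.+1 = (2 ^ t + 2 ^ t)%N by rewrite expnS; lia.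
case e : (gate_at C i) ok sm IHj vE => [|j|l|l] /=.
- by move=> _ _ _ _; apply: lowdeg_input => //; rewrite e.
- move=> _ _ /(_ j (mem_head _ _))[P dP eP] vE.
  exists (fun U => 1 + (-1) * P U)%R.
    apply: lowdegD; first exact: lowdeg_const.
    by apply: lowdegZ; apply: lowdegW dP; rewrite e2; lia.
  by move=> U uU; rewrite /val vE eP //= /val; case: (nth _ _ _).
- case: l e => [|x [|y []]] //= e _ _ IHj vE.
  have [P dP eP] := IHj x (mem_head _ _).
  have [R dR eR] := IHj y ltac:(by rewrite !inE eqxx orbT).
  exists (fun U => P U * R U)%R; first by rewrite e2; exact: lowdegM.
  move=> U uU; rewrite /val vE eP // eR //= andbT /val.
  by case: (nth _ _ _); case: (nth _ _ _).
- case: l e => [|x [|y []]] //= e _ _ IHj vE.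
  have [P dP eP] := IHj x (mem_head _ _).
  have [R dR eR] := IHj y ltac:(by rewrite !inE eqxx orbT).
  exists (fun U => (P U + R U) + (-1) * (P U * R U))%R.
    apply: lowdegD; last by rewrite e2; apply: lowdegZ; exact: lowdegM.
    by apply: lowdegD; [apply: lowdegW dP | apply: lowdegW dR]; rewrite e2; lia.
  move=> U uU; rewrite /val vE eP // eR //= orbF /val.
  by case: (nth _ _ _); case: (nth _ _ _).
Qed.

Lemma lowdeg_count q (l : seq nat) :
  (forall j, j \in l -> exists2 P, lowdeg q P & forall U, uniq U -> P U = Posz (val U j)) ->
  exists2 P, lowdeg q P & forall U, uniq U -> P U = Posz (count (val U) l).
Proof.
elim: l => [|j l IH] h; first by exists (fun=> 0%R) => //; exact: lowdeg_const.
have [P dP eP] := h j (mem_head _ _).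
have [R dR eR] := IH (fun k kl => h k ltac:(by rewrite in_cons kl orbT)).
exists (fun U => P U + R U)%R; first exact: lowdegD.
by move=> U uU; rewrite eP // eR.
Qed.

(** A large gate uses up the weft, so [lowdeg_small] applies to its arguments, and the number of
    true ones is a sum of their values. Above it, two digits are combined linearly, which does not
    raise the degree. *)
Lemma lowdeg_digits t i : i < size C -> depth_at t i -> weft_at 1 i ->
  exists2 P, lowdeg (2 ^ t) P &
    forall U, uniq U -> P U = Posz (digits t C (gate_values (mem U) C) i).
Proof.
have bit (b : bool) : (if b then 1 else 0) = b :> nat by case: b.
elim: t i => [|t IH] i iC.
  move=> /(depth_at0 iC) inp _; have [P dP eP] := lowdeg_input 0 iC inp.
  by exists P => // U uU; rewrite eP //= bit.
move=> di wi; have [lg|sm] := ltnP 2 (size (gate_args (gate_at C i))).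
  have [|P dP eP] := @lowdeg_count (2 ^ t.+1) (gate_args (gate_at C i)); last first.
    by exists P => // U uU; rewrite eP //= -/(gate_at C i) lg.
  move=> j ji; have [||| P dP eP] := @lowdeg_small t j.
  - exact: ltn_trans (gate_argsP iC ji) iC.
  - exact: depth_at_arg di ji.
  - by have := weft_at_arg wi ji; rewrite /large lg.
  by exists P => //; apply: lowdegW dP; rewrite leq_exp2l.
have IHj j : j \in gate_args (gate_at C i) ->
    exists2 P, lowdeg (2 ^ t) P &
      forall U, uniq U -> P U = Posz (digits t C (gate_values (mem U) C) j).
  move=> ji; apply: IH; first exact: ltn_trans (gate_argsP iC ji) iC.
    exact: depth_at_arg di ji.
  by move=> u p uC up pth la; apply: leq_trans (weft_at_arg wi ji uC up pth la) _; lia.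
have le2 : 2 ^ t <= 2 ^ t.+1 by rewrite leq_exp2l.
have sm' : (2 < size (gate_args (gate_at C i))) = false by rewrite ltnNge sm.
have [s2|s2] := eqVneq (size (gate_args (gate_at C i))) 2.
  have [P dP eP] := IHj _ (mem_nth 0 (ltac:(by rewrite s2) : 0 < size (gate_args (gate_at C i)))).
  have [R dR eR] := IHj _ (mem_nth 0 (ltac:(by rewrite s2) : 1 < size (gate_args (gate_at C i)))).
  exists (fun U => P U + Posz (base t C) * R U)%R.
    by apply: lowdegD; [apply: lowdegW dP | apply: lowdegZ; apply: lowdegW dR].
  by move=> U uU; rewrite eP // eR //= -/(gate_at C i) sm' s2 PoszD PoszM.
have [s1|s1] := eqVneq (size (gate_args (gate_at C i))) 1.
  have [P dP eP] := IHj _ (mem_nth 0 (ltac:(by rewrite s1) : 0 < size (gate_args (gate_at C i)))).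
  exists P; first exact: lowdegW dP.
  by move=> U uU; rewrite eP //= -/(gate_at C i) sm' (negbTE s2) s1.
have inp : is_input (gate_at C i).
  have [_ /(_ i iC)[ok _]] := wfC.
  by case: (gate_at C i) ok sm s1 s2 => //= l /andP[_ +]; case: (size l) => [|[|[|]]].
have [P dP eP] := lowdeg_input t.+1 iC inp.
exists P => // U uU.
by rewrite eP //= -/(gate_at C i) sm' (negbTE s2) (negbTE s1) bit.
Qed.

End Circuits.

(** * The constraint satisfaction problem *)

Definition onehot (n i : nat) : bitseq := set_nth false (nseq n false) i true.

Lemma size_onehot n i : i < n -> size (onehot n i) = n.
Proof. by move=> lt; rewrite size_set_nth size_nseq; apply/maxn_idPr. Qed.

Lemma mask_onehot (T : Type) (x0 : T) n i s :
  i < n -> size s = n -> mask (onehot n i) s = [:: nth x0 s i].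
Proof.
elim: n i s => [|n IH] [|i] [|x s] //=; rewrite /onehot /=.
  by move=> _ [<-]; rewrite mask_false.
by move=> lt [sz]; exact: IH.
Qed.

Lemma count_onehot n i : i < n -> count id (onehot n i) = 1.
Proof.
elim: n i => [|n IH] [|i] //=; rewrite /onehot /=; last exact: IH.
by move=> _; rewrite count_nseq mul0n.
Qed.

(** Both sides list the entries of [s] selected by [b] and by [c]. The left one is computed from
    [mask b s], the right one from [mask c s], which is the form that the constraints must have. *)
Lemma mask_maskC (T : Type) (b c : bitseq) (s : seq T) :
  size b = size s -> size c = size s ->
  mask (mask b c) (mask b s) = mask (mask c b) (mask c s).
Proof.
elim: s b c => [|x s IH] [|[] b] [|[] c] //= [sb] [sc]; rewrite IH //.
Qed.

Lemma mask_onehot_inj (T : Type) (b : bitseq) (s t : seq T) :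
  size s = count id b -> size t = count id b ->
  (forall i, i < size b -> nth false b i ->
     mask (mask b (onehot (size b) i)) s = mask (mask b (onehot (size b) i)) t) -> s = t.
Proof.
elim: b s t => [|[] b IH] s t /=; first by case: s => //; case: t.
  case: s => // x s; case: t => // y t [ss] [st] h.
  have := h 0 isT isT; rewrite /onehot /= => -[-> _]; congr (_ :: _).
  by apply: IH => // i ib bi; have := h i.+1 ib bi; rewrite /onehot /=.
move=> ss st h; apply: IH => // i ib bi.
by have := h i.+1 ib bi; rewrite /onehot /=.
Qed.

Lemma pairwise_mask2 (T : Type) (r : rel T) (s : seq T) :
  (forall b, size b = size s -> count id b <= 2 -> pairwise r (mask b s)) -> pairwise r s.
Proof.
elim: s => //= x s IH h; apply/andP; split; last first.
  by apply: IH => b sb cb; apply: (h (false :: b)) => //=; rewrite sb.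
apply/(all_nthP x) => i lt.
have := h (true :: onehot (size s) i); rewrite /= size_onehot // count_onehot //.
by move=> /(_ erefl isT); rewrite (mask_onehot x) //= !andbT.
Qed.

Definition input_tuples (l : seq nat) : nat -> seq (seq nat) :=
  fix tuples q := if q is q'.+1 then
    [::] :: flatten [seq [seq x :: t | t <- tuples q' & all (ltn x) t] | x <- l]
  else [:: [::]].

Lemma mem_input_tuples l q t :
  (t \in input_tuples l q) = [&& size t <= q, all (mem l) t & pairwise ltn t].
Proof.
elim: q t => [|q IH] [|x t] //=.
apply/flatten_mapP/and3P => [[y yl /mapP[t']]|[sz /andP[xl tl] /andP[xt pt]]].
  rewrite mem_filter IH => /andP[at' /and3P[st tl pt]] [-> ->].
  by split=> //; apply/andP.
by exists x => //; apply: map_f; rewrite mem_filter xt IH -ltnS sz tl.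
Qed.

Lemma uniq_input_tuples l q : uniq l -> uniq (input_tuples l q).
Proof.
move=> ul; elim: q => //= q IH; apply/andP; split.
  by apply/negP => /flatten_mapP[x _ /mapP[]].
apply: allpairs_uniq_dep => //; first by move=> x _; exact: filter_uniq.
by move=> [x t] [y t'] _ _ /= [-> ->].
Qed.

(** [2 ^ d] is the degree. The summand 2 guarantees, for every [d], that any two positions are
    selected by some word, so that the chosen inputs can be forced to be increasing and hence
    distinct. *)
Definition arity (d : nat) : nat := (2 ^ d).+2.

Definition short_words (d k : nat) : seq (seq nat) :=
  [seq w <- words k | nonzeros w <= arity d].

Definition output_digits (d : nat) (C : circuit) (U : seq nat) : nat :=
  digits d C (gate_values (mem U) C) (size C).-1.

(** The sign is the parity of the number of letters 1, and [B - v] stands for the negative of [v].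
    Nothing is lost modulo [B], as the complete sum equals a number below [B]. *)
Definition add_term (B : nat) (w : seq nat) (p v : nat) : nat :=
  (p + (if odd (count_mem 1 w) then B - v else v)) %% B.

(* The value [(p, t)] of the variable for a word [w] consists of the inputs [t]
   selected by [w] and of the sum [p], modulo [base d C], of the terms of the
   inclusion-exclusion formula for the words before [w]. *)
Definition next_sum (d : nat) (C : circuit) (ws : seq (seq nat)) (a : nat) (x : nat * seq nat) : nat :=
  add_term (base d C) (nth [::] ws a) x.1 (output_digits d C x.2).

(** The unary conditions are part of the domains: the first variable starts with the sum 0, and the
    sum completed by the last one must decode to true at the output gate. *)
Definition values (d : nat) (C : circuit) (ws : seq (seq nat)) (a : nat) : seq (nat * seq nat) :=
  [seq x <- [seq (p, t) | p <- iota 0 (base d C), t <- input_tuples (input_nodes C) (arity d)] |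
    [&& size x.2 == count id (twos (nth [::] ws a)), (a == 0) ==> (x.1 == 0) &
      (a.+1 == size ws) ==> decode d C (size C).-1 (next_sum d C ws a x)]].

(** This is what the variable [a] shares with [b]: the inputs selected by both words and, for
    consecutive words, the sum handed on, which is [next_sum] for the earlier one and the stored sum
    for the later one. For [b = a] the value is determined; otherwise the constant 0 leaves the sums
    unrelated. *)
Definition common (d : nat) (C : circuit) (ws : seq (seq nat)) (a b : nat) (x : nat * seq nat) :
    seq nat * nat :=
  (mask (mask (twos (nth [::] ws a)) (twos (nth [::] ws b))) x.2,
   if b == a.+1 then next_sum d C ws a x else if (a == b) || (a == b.+1) then x.1 else 0).

Section Constraints.
Variables (d : nat) (C : circuit) (k : nat).
Hypothesis wC : weft_class 1 d C.

Let ws := short_words d k.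
Let B := base d C.
Let out := (size C).-1.

Let wfC : circuit_wf C. Proof. by case: wC. Qed.
Let outC : out < size C. Proof. by case: wfC; rewrite /out; case: (size C). Qed.

Lemma base_gt0 : 0 < B. Proof. exact: leq_ltn_trans (base_ge C d). Qed.

Lemma circuit_valueE a : circuit_value a C = nth false (gate_values a C) out.
Proof. by rewrite /circuit_value -/(gate_values a C) -nth_last size_gate_values. Qed.

Lemma output_digitsP U : output_digits d C U < B /\
  decode d C out (output_digits d C U) = circuit_value (mem U) C.
Proof. by rewrite circuit_valueE; exact: (digitsP wfC). Qed.

Definition partial_sum (S : seq nat) (v : seq (seq nat)) : nat :=
  foldl (fun p w => add_term B w p (output_digits d C (mask (twos w) S))) 0 v.

Lemma partial_sum_lt S v : partial_sum S v < B.
Proof.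
case: (lastP v) => [|v' w]; first exact: base_gt0.
by rewrite /partial_sum foldl_rcons ltn_mod base_gt0.
Qed.

Lemma partial_sumE S v :
  (Posz (partial_sum S v) =
   (\sum_(w <- v) (-1) ^+ count_mem 1%N w * Posz (output_digits d C (mask (twos w) S)))%R
   %[mod B])%Z.
Proof.
elim/last_ind: v => [|v w IH]; first by rewrite big_nil.
rewrite -cats1 big_cat big_seq1 /= /partial_sum foldl_cat /= -/(partial_sum S v).
set F := output_digits _ _ _; have [FB _] : F < B /\ _ := output_digitsP _.
rewrite /add_term -modz_nat modz_mod PoszD -modzDml IH modzDml -signr_odd.
case: (odd _); last by rewrite expr0 mul1r.
rewrite -(subzn (ltnW FB)) expr1 mulN1r.
by rewrite addrA addrAC -[X in (_ = X %[mod _])%Z]addr0 -modzDmr modzz addr0.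
Qed.

(** Interpolation gives equality modulo [B], and both sides are below [B]. *)
Lemma partial_sum_words S : uniq S -> size S = k ->
  partial_sum S ws = output_digits d C S.
Proof.
move=> uS sS; have [P dP eP] : exists2 P, lowdeg (arity d) P &
    forall U, uniq U -> P U = Posz (output_digits d C U).
  have [_ dC tC] := wC.
  have [||P dP eP] := @lowdeg_digits C wfC d out outC.
  - by move=> u p uC up pth la; apply: (dC u p).
  - by move=> u p uC up pth la; apply: (tC u p).
  - by exists P => //; apply: lowdegW dP; rewrite /arity; lia.
have := lowdeg_interpolation S dP; rewrite -big_filter sS -/(short_words d k) -/ws.
rewrite (eq_bigr (fun w => (-1) ^+ count_mem 1%N w * Posz (output_digits d C (mask (twos w) S)))%R);
  last by move=> w _; rewrite eP // mask_uniq.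
rewrite eP // => e; have := partial_sumE S ws; rewrite e !modz_nat => -[].
by rewrite !modn_small ?partial_sum_lt //; case: (output_digitsP S).
Qed.

Lemma short_word_mem (b : bitseq) : size b = k -> count id b <= arity d ->
  exists2 w, w \in ws & twos w = b.
Proof.
move=> sb cb; exists [seq if x then 2 else 0 | x <- b]; last first.
  by rewrite /twos -map_comp -[RHS]map_id; apply: eq_map => -[].
rewrite mem_filter mem_words size_map sb eqxx /nonzeros count_map.
rewrite (@eq_count _ _ id) ?cb; last by case.
by apply/allP => _ /mapP[x _ ->]; case: x.
Qed.

Lemma size_short_words_gt0 : 0 < size ws.
Proof.
have [|w] := @short_word_mem (nseq k false) (size_nseq _ _).
  by rewrite count_nseq mul0n.
by case: ws.
Qed.

Lemma short_words_size w : w \in ws -> size w = k /\ count id (twos w) <= arity d.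
Proof.
rewrite mem_filter mem_words => /and3P[nz /eqP -> _]; split=> //.
apply: leq_trans nz; rewrite /twos count_map; apply: sub_count => c /= /eqP ->.
by [].
Qed.

Let m := size ws.
Let word a := nth [::] ws a.

Lemma next_sum_partial (S : seq nat) a : a < m ->
  next_sum d C ws a (partial_sum S (take a ws), mask (twos (word a)) S) =
  partial_sum S (take a.+1 ws).
Proof. by move=> am; rewrite (take_nth [::]) // /partial_sum foldl_rcons. Qed.

(** Each variable takes the true inputs selected by its word and the sum of the terms before it. The
    true inputs are listed in increasing order, so the selections are in [input_tuples]. *)
Lemma solution_of_assignment a : weight a C = k -> circuit_value a C ->
  exists u, solution m (common d C ws) (values d C ws) u.
Proof.
move=> wa va; pose S := [seq i <- input_nodes C | a i].
have inputs_sorted : pairwise ltn (input_nodes C).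
  rewrite -(sorted_pairwise ltn_trans); apply: sorted_filter; first exact: ltn_trans.
  exact: iota_ltn_sorted.
have sS : size S = k by rewrite size_filter.
have pS : pairwise ltn S by rewrite pairwise_filter.
have uS : uniq S by rewrite !filter_uniq ?iota_uniq.
have vS : circuit_value (mem S) C.
  rewrite circuit_valueE (@eq_gate_values C wfC _ a) -?circuit_valueE //.
  by move=> i ii; rewrite /= mem_filter ii andbT.
have wk b : b < m -> size (twos (word b)) = k /\ count id (twos (word b)) <= arity d.
  by move=> bm; have [<- ?] := short_words_size (mem_nth [::] bm); rewrite size_map.
exists (fun b => (partial_sum S (take b ws), mask (twos (word b)) S)); split.
  move=> b bm; have [sw cw] := wk b bm; rewrite mem_filter; apply/andP; split.
    rewrite next_sum_partial //= size_mask ?sw ?sS // eqxx /=; apply/andP; split.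
      by apply/implyP => /eqP ->; rewrite take0.
    apply/implyP => /eqP ->; rewrite take_size partial_sum_words //.
    by case: (output_digitsP S) => _ ->.
  apply/allpairsP; exists (partial_sum S (take b ws), mask (twos (word b)) S).
  split=> //; first by rewrite mem_iota partial_sum_lt.
  rewrite mem_input_tuples size_mask ?sw ?sS // cw /=; apply/andP; split.
    apply/allP => i /mem_mask; rewrite mem_filter => /andP[_]; exact.
  by apply: subseq_pairwise pS; exact: mask_subseq.
move=> b c bm cm; rewrite /common; congr (_, _).
  by apply: mask_maskC; rewrite sS; case: (wk _ bm) (wk _ cm) => + _ [+ _].
have [->|cb] := eqVneq c b.+1.
  rewrite next_sum_partial // (_ : b == b.+2 = false) ?eqxx ?orbT; last lia.
  by [].
have [->|bc] := eqVneq b c.+1; first by rewrite orbT next_sum_partial.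
by rewrite !orbF eq_sym; case: eqP => // ->.
Qed.

(** The words with a single letter 2 name [k] inputs, and agreement with them determines the tuples
    of all words. Words with two letters 2 make these inputs increasing, hence distinct. Induction
    along the words identifies the stored sums with the partial sums, so the test in the last domain
    is applied to the true output number. *)
Lemma assignment_of_solution u : solution m (common d C ws) (values d C ws) u ->
  exists a, weight a C = k /\ circuit_value a C.
Proof.
move=> [uv uc].
pose t w := (u (index w ws)).2.
have m0 := size_short_words_gt0.
have tP w : w \in ws ->
    [/\ size (t w) = count id (twos w), all (mem (input_nodes C)) (t w) & pairwise ltn (t w)].
  move=> wws; have := uv (index w ws); rewrite index_mem => /(_ wws).
  rewrite mem_filter nth_index // => /andP[/and3P[/eqP st _ _] /allpairsP[[p t'] [_ + e]]].
  by move: st; rewrite /t e mem_input_tuples => st /and3P[].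
have tC w w' : w \in ws -> w' \in ws ->
    mask (mask (twos w) (twos w')) (t w) = mask (mask (twos w') (twos w)) (t w').
  move=> h h'; have := uc (index w ws) (index w' ws).
  by rewrite !index_mem => /(_ h h')[]; rewrite !nth_index.
pose e i := [seq if x then 2 else 0 | x <- onehot k i].
have eP i : i < k -> e i \in ws /\ twos (e i) = onehot k i.
  move=> ik; rewrite /e; split; last first.
    by rewrite /twos -map_comp -[RHS]map_id; apply: eq_map => -[].
  rewrite mem_filter mem_words size_map size_onehot // eqxx /nonzeros count_map.
  rewrite (@eq_count _ _ id) ?count_onehot //=; last by case.
  by apply/allP => _ /mapP[x _ ->]; case: x.
pose S := [seq head 0 (t (e i)) | i <- iota 0 k].
have sS : size S = k by rewrite size_map size_iota.
have tE w : w \in ws -> t w = mask (twos w) S.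
  move=> wws; have [sw _] := short_words_size wws; have [st _ _] := tP w wws.
  have sb : size (twos w) = k by rewrite size_map.
  apply: (@mask_onehot_inj _ (twos w)) => //.
    by rewrite size_mask // sb sS.
  move=> i; rewrite sb => ik bi; have [ews te] := eP i ik.
  rewrite -te tC // te mask_maskC ?size_onehot ?sb ?sS //.
  rewrite !(mask_onehot false) // bi (mask_onehot 0) //= (nth_map 0) ?size_iota //.
  rewrite nth_iota // add0n; have [] := tP _ ews.
  by rewrite te count_onehot //; case: (t (e i)) => [|x []].
have bits b : size b = k -> count id b <= arity d ->
    all (mem (input_nodes C)) (mask b S) /\ pairwise ltn (mask b S).
  move=> sb cb; have [w wws <-] := short_word_mem sb cb.
  by rewrite -tE //; have [] := tP w wws.
have pS : pairwise ltn S.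
  apply: pairwise_mask2 => b sb cb; apply: (bits b _ _).2; first by rewrite sb.
  by apply: leq_trans cb _; rewrite /arity; lia.
have uS : uniq S by apply: (sorted_uniq ltn_trans ltnn); rewrite (sorted_pairwise ltn_trans).
have Sin i : i \in S -> i \in input_nodes C.
  move=> /(nthP 0)[j jS <-]; rewrite sS in jS.
  have [|+ _] := bits (onehot k j) (size_onehot jS); first by rewrite count_onehot // /arity; lia.
  by rewrite (mask_onehot 0) //= andbT.
exists (mem S); split.
  rewrite /weight -size_filter -sS; apply: perm_size; apply: uniq_perm => //.
    by rewrite !filter_uniq // iota_uniq.
  by move=> i; rewrite mem_filter /=; apply/andP/idP => [[]|h] //; split=> //; exact: Sin.
have uE a : a < m -> u a = (partial_sum S (take a ws), mask (twos (word a)) S).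
  move=> am.
  have e2 : (u a).2 = mask (twos (word a)) S.
    by rewrite -tE ?mem_nth // /t index_uniq // filter_uniq // uniq_words.
  suff e1 : (u a).1 = partial_sum S (take a ws) by rewrite -e1 -e2; case: (u a).
  elim: a am {e2} => [|a IH] am.
    have := uv 0 am; rewrite mem_filter /= => /andP[/and3P[_ /eqP -> _] _].
    by rewrite take0.
  have am' := ltnW am.
  have e2 : (u a).2 = mask (twos (word a)) S.
    by rewrite -tE ?mem_nth // /t index_uniq // filter_uniq // uniq_words.
  have := congr1 snd (uc a a.+1 am' am); rewrite /common /= eqxx.
  rewrite (_ : a == a.+2 = false) ?orbT; last lia.
  move=> <-; rewrite -next_sum_partial // -IH // -e2.
  by case: (u a).
have lm : m.-1 < m by rewrite prednK.
have := uv m.-1 lm; rewrite mem_filter uE // next_sum_partial // prednK // eqxx.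
move=> /andP[/and3P[_ _]] /=; rewrite take_size partial_sum_words //.
by case: (output_digitsP S) => _ ->.
Qed.

(** A word shares with itself all entries of its tuple. This provides the injectivity that the
    gadget asks of [phi]. *)
Lemma common_inj a x y : a < m -> x \in values d C ws a -> y \in values d C ws a ->
  common d C ws a a x = common d C ws a a y -> x = y.
Proof.
move=> am; rewrite !mem_filter => /andP[/and3P[/eqP sx _ _] _] /andP[/and3P[/eqP sy _ _] _].
rewrite /common eqxx (_ : a == a.+1 = false); last lia.
rewrite /=; move: sx sy; case: x y => [p s] [q t] /=.
set b := twos _ => ss st [es <-]; congr (_, _).
have mt (r : seq nat) : size r = count id b -> mask (mask b b) r = r.
  by elim: b r {ss st es} => [|[] b' IH] [|z r] //= [h]; rewrite IH.
by rewrite -(mt s) // -(mt t).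
Qed.

Lemma uniq_values a : uniq (values d C ws a).
Proof.
apply: filter_uniq; apply: allpairs_uniq; rewrite ?iota_uniq //.
  by apply: uniq_input_tuples; rewrite filter_uniq // iota_uniq.
by move=> [p s] [q t].
Qed.

End Constraints.

(** * Execution of programs *)

Fixpoint expr_bound (e : expr) : nat :=
  match e with
  | EVar i => i.+1
  | ELeaf => 0
  | ENode e1 e2 => maxn (expr_bound e1) (expr_bound e2)
  | ELeft e1 | ERight e1 => expr_bound e1
  end.

Fixpoint cmd_bound (c : cmd) : nat :=
  match c with
  | Skip => 0
  | Assign i e => maxn i.+1 (expr_bound e)
  | Seq c1 c2 => maxn (cmd_bound c1) (cmd_bound c2)
  | If e c1 c2 => maxn (expr_bound e) (maxn (cmd_bound c1) (cmd_bound c2))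
  | While e c1 => maxn (expr_bound e) (cmd_bound c1)
  end.

Lemma tsize_gt0 x : 0 < tsize x. Proof. by case: x. Qed.

Lemma ecost_size s e : tsize (eval s e) <= ecost s e.
Proof. by case: e => *; exact: leq_addr. Qed.

Lemma exec_frame c s t s' :
  exec c s t s' -> forall j, cmd_bound c <= j -> s' j = s j.
Proof.
elim=> {c s t s'} //=.
- by move=> s i e j; rewrite geq_max /upd => /andP[+ _]; case: eqP => // ->; rewrite ltnn.
- move=> s1 s2 s3 c1 c2 t1 t2 _ IH1 _ IH2 j; rewrite geq_max => /andP[h1 h2].
  by rewrite IH2 // IH1.
- by move=> s s' e c1 c2 t _ _ IH j; rewrite !geq_max => /and3P[_ h _]; exact: IH.
- by move=> s s' e c1 c2 t _ _ IH j; rewrite !geq_max => /and3P[_ _ h]; exact: IH.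
- move=> s1 s2 s3 e c t1 t2 _ _ IH1 _ IH2 j h; rewrite IH2 // IH1 //.
  by move: h; rewrite geq_max => /andP[].
Qed.

Lemma eval_agree e n (s r : store) : expr_bound e <= n ->
  (forall j, j < n -> s j = r j) -> eval s e = eval r e /\ ecost s e = ecost r e.
Proof.
move=> + agr; elim: e => //= [i|e1 IH1 e2 IH2|e1 IH1|e1 IH1].
- by move=> /agr ->.
- by rewrite geq_max => /andP[/IH1[-> ->] /IH2[-> ->]].
- by move=> /IH1[-> ->].
- by move=> /IH1[-> ->].
Qed.

(** A program specified only on an otherwise empty store can therefore be run while data are kept in
    variables beyond its bound. *)
Lemma exec_agree c s t s' : exec c s t s' ->
  forall n r, cmd_bound c <= n -> (forall j, j < n -> s j = r j) ->
  exists2 r', exec c r t r' & forall j, j < n -> s' j = r' j.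
Proof.
elim=> {c s t s'} /=.
- by move=> s n r _ agr; exists r => //; constructor.
- move=> s i e n r; rewrite geq_max => /andP[_ be] agr.
  have [-> ->] := eval_agree be agr.
  exists (upd r i (eval r e)); first by constructor.
  by move=> j jn; rewrite /upd; case: eqP => // _; exact: agr.
- move=> s1 s2 s3 c1 c2 t1 t2 _ IH1 _ IH2 n r.
  rewrite geq_max => /andP[b1 b2] agr.
  have [r1 e1 agr1] := IH1 n r b1 agr; have [r2 e2 agr2] := IH2 n r1 b2 agr1.
  by exists r2 => //; apply: ExecSeq e1 e2.
- move=> s s' e c1 c2 t nd _ IH n r; rewrite !geq_max => /and3P[be b1 _] agr.
  have [ev ec] := eval_agree be agr; have [r' e' agr'] := IH n r b1 agr.
  by exists r' => //; rewrite ec; apply: ExecIfTrue => //; rewrite -ev.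
- move=> s s' e c1 c2 t nd _ IH n r; rewrite !geq_max => /and3P[be _ b1] agr.
  have [ev ec] := eval_agree be agr; have [r' e' agr'] := IH n r b1 agr.
  by exists r' => //; rewrite ec; apply: ExecIfFalse => //; rewrite -ev.
- move=> s e c nd n r; rewrite geq_max => /andP[be b1] agr.
  have [ev ec] := eval_agree be agr.
  by exists r => //; rewrite ec; apply: ExecWhileEnd; rewrite -ev.
- move=> s1 s2 s3 e c t1 t2 nd _ IH1 _ IH2 n r b agr.
  have /andP[be b1] : (expr_bound e <= n) && (cmd_bound c <= n) by rewrite -geq_max.
  have [ev ec] := eval_agree be agr.
  have [r1 e1 agr1] := IH1 n r b1 agr; have [r2 e2 agr2] := IH2 n r1 b agr1.
  by exists r2 => //; rewrite ec; apply: (ExecWhileStep _ e1 e2); rewrite -ev.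
Qed.

(** Writing a tree costs at least its size. This bounds the output of a given reduction by its input
    and its running time. *)
Lemma exec_size c s t s' i : exec c s t s' -> tsize (s' i) <= tsize (s i) + t.
Proof.
elim=> {c s t s'} /=; try by move=> *; lia.
move=> s j e; rewrite /upd; have := ecost_size s e; case: eqP => _; lia.
Qed.

(** Total correctness with a time budget; as [T] is only an upper bound, the rules compose without
    exact times. *)
Definition reach (c : cmd) (s : store) (T : nat) (P : store -> Prop) : Prop :=
  exists t s', [/\ exec c s t s', t <= T & P s'].

Lemma reach_assign i e s T (P : store -> Prop) :
  ecost s e < T -> P (upd s i (eval s e)) -> reach (Assign i e) s T P.
Proof. by move=> le Ps; exists (ecost s e).+1, (upd s i (eval s e)); split=> //; constructor. Qed.

Lemma reach_seq c1 c2 s T1 T2 T (P1 P : store -> Prop) :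
  reach c1 s T1 P1 -> T1 + T2 < T ->
  (forall s1, (forall j, cmd_bound c1 <= j -> s1 j = s j) -> P1 s1 -> reach c2 s1 T2 P) ->
  reach (Seq c1 c2) s T P.
Proof.
move=> [t1 [s1 [e1 le1 P1s]]] le h.
have [t2 [s2 [e2 le2 P2s]]] := h _ (exec_frame e1) P1s.
by exists (t1 + t2).+1, s2; split=> //; [apply: ExecSeq e1 e2 | lia].
Qed.

Lemma reach_if e c1 c2 s T1 T (P : store -> Prop) :
  ecost s e + T1 < T ->
  reach (if is_node (eval s e) then c1 else c2) s T1 P -> reach (If e c1 c2) s T P.
Proof.
move=> le [t [s' [ex le1 Ps]]]; exists (ecost s e + t).+1, s'; split=> //; last lia.
by case: ifP ex => [h|/negbT h] ex; [apply: ExecIfTrue | apply: ExecIfFalse].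
Qed.

(** * Polynomial-time computable functions *)

(* The measure may exceed the size of the encoding: this is how the running
   time is allowed to depend exponentially on a parameter. *)
Class Enc (A : Type) := {
  enc : A -> tree;
  meas : A -> nat;
  meas_ge : forall a, tsize (enc a) <= meas a
}.

#[export] Instance Enc_unit : Enc unit :=
  {| enc := fun=> Leaf; meas := fun=> 1; meas_ge := fun=> isT |}.

#[export] Instance Enc_bool : Enc bool :=
  {| enc := enc_bool; meas := fun b => tsize (enc_bool b); meas_ge := fun=> leqnn _ |}.

#[export] Instance Enc_nat : Enc nat :=
  {| enc := enc_nat; meas := fun n => tsize (enc_nat n); meas_ge := fun=> leqnn _ |}.

Lemma meas_ge_pair (A B : Type) (EA : Enc A) (EB : Enc B) (x : A * B) :
  tsize (Node (enc x.1) (enc x.2)) <= (meas x.1 + meas x.2).+1.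
Proof. by rewrite /= ltnS leq_add ?meas_ge. Qed.

#[export] Instance Enc_pair (A B : Type) (EA : Enc A) (EB : Enc B) : Enc (A * B) :=
  {| meas_ge := meas_ge_pair EA EB |}.

Definition meas_seq (A : Type) {EA : Enc A} (s : seq A) : nat :=
  foldr (fun x n => (meas x + n).+1) 1 s.

Lemma meas_ge_seq (A : Type) (EA : Enc A) (s : seq A) :
  tsize (enc_seq enc s) <= meas_seq s.
Proof. by elim: s => //= x s IH; rewrite ltnS leq_add ?meas_ge. Qed.

#[export] Instance Enc_seq (A : Type) (EA : Enc A) : Enc (seq A) :=
  {| meas_ge := meas_ge_seq EA |}.

#[export] Instance Enc_gate : Enc gate :=
  {| enc := enc_gate; meas := fun g => tsize (enc_gate g); meas_ge := fun=> leqnn _ |}.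

(** The base is at least 2, so a single exponent absorbs constant factors and summands. *)
Definition pbound (A : Type) {EA : Enc A} (T : A -> nat) : Prop :=
  exists c, forall a, T a <= (meas a).+2 ^ c.

Section PolynomialBounds.
Context (A B : Type) {EA : Enc A} {EB : Enc B}.
Implicit Types T : A -> nat.

Lemma pbound_le T T' : pbound T' -> (forall a, T a <= T' a) -> pbound T.
Proof. by move=> [c h] le; exists c => a; apply: leq_trans (le a) (h a). Qed.

Lemma pbound_const n : pbound (fun _ : A => n).
Proof.
exists n => a; apply: leq_trans (ltnW (ltn_expl n (isT : 1 < 2))) _.
by case: n => // n; rewrite leq_exp2r.
Qed.

Lemma pbound_meas : pbound (fun a : A => meas a).
Proof. by exists 1 => a; rewrite expn1; lia. Qed.

Lemma pbound_add T T' : pbound T -> pbound T' -> pbound (fun a => T a + T' a).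
Proof.
move=> [c h] [c' h']; exists (c + c').+1 => a.
have := h a; have := h' a; set X := (meas a).+2 => H' H.
have P n : 0 < X ^ n by rewrite expn_gt0.
rewrite expnS expnD.
apply: leq_trans (leq_add H H') _; rewrite /X.
have := P c; have := P c'; move: (X ^ c) (X ^ c') => u v; nia.
Qed.

Lemma pbound_mul T T' : pbound T -> pbound T' -> pbound (fun a => T a * T' a).
Proof. by move=> [c h] [c' h']; exists (c + c') => a; rewrite expnD leq_mul. Qed.

Lemma pbound_S T : pbound T -> pbound (fun a => (T a).+1).
Proof.
move=> h; apply: (pbound_le (pbound_add h (pbound_const 1))) => a.
by rewrite addn1.
Qed.

Lemma pbound_exp T n : pbound T -> pbound (fun a => T a ^ n).
Proof.
move=> h; elim: n => [|n IH]; first exact: pbound_const.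
by apply: (pbound_le (pbound_mul h IH)) => a; rewrite expnS.
Qed.

Lemma pbound_comp (g : B -> nat) (f : A -> B) T :
  pbound g -> pbound T -> (forall a, meas (f a) <= T a) -> pbound (fun a => g (f a)).
Proof.
move=> [c hg] hT le; apply: (@pbound_le _ (fun a => (T a + 2) ^ c)).
  exact: pbound_exp (pbound_add hT (pbound_const 2)).
move=> a; apply: leq_trans (hg _) _.
by case: c {hg} => // c; rewrite leq_exp2r //; have := le a; lia.
Qed.

End PolynomialBounds.

(** The other variables of [s] are arbitrary, so programs can be chained without cleaning up. The
    measure of the result is bounded separately, since it may exceed the size of the encoding, which
    is all that the running time controls. *)
Definition polytime (A B : Type) {EA : Enc A} {EB : Enc B} (f : A -> B) : Prop :=
  exists (p : cmd) (T : A -> nat), pbound T /\ forall a,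
    meas (f a) <= T a /\
    forall s, s 0 = enc a -> reach p s (T a) (fun s' => s' 0 = enc (f a)).

Lemma updE s i x j : upd s i x j = if j == i then x else s j.
Proof. by []. Qed.

Section PolytimeClosure.
Context (A : Type) {EA : Enc A}.

Lemma polytime_ext (B : Type) {EB : Enc B} (f g : A -> B) :
  f =1 g -> polytime f -> polytime g.
Proof.
by move=> fg [p [T [hT h]]]; exists p, T; split=> // a; have := h a; rewrite fg.
Qed.

Lemma polytime_id : polytime (fun a : A => a).
Proof.
exists Skip, (fun a => (meas a).+1); split; first by apply: pbound_S; exact: pbound_meas.
by move=> a; split=> // s s0; exists 1, s; split=> //; constructor.
Qed.

Lemma polytime_comp (B C : Type) {EB : Enc B} {EC : Enc C} (g : B -> C) (f : A -> B) :
  polytime g -> polytime f -> polytime (fun a => g (f a)).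
Proof.
move=> [q [U [hU hq]]] [p [T [hT hp]]].
exists (Seq p q), (fun a => (T a + U (f a)).+2); split.
  do 2!apply: pbound_S; apply: pbound_add => //.
  by apply: (pbound_comp hU hT) => a; case: (hp a).
move=> a; have [mf hpa] := hp a; have [mg hqa] := hq (f a); split; first lia.
move=> s s0; apply: (reach_seq (T2 := U (f a)) (hpa s s0)); first lia.
by move=> s1 _ h1; exact: hqa.
Qed.

Lemma polytime_expr (B C : Type) {EB : Enc B} {EC : Enc C} (f : A -> C)
    (e : expr) (K : A -> nat) :
  pbound K -> (forall a, meas (f a) <= K a) ->
  (forall a s, s 0 = enc a -> eval s e = enc (f a) /\ ecost s e <= K a) ->
  polytime f.
Proof.
move=> hK mf h; exists (Assign 0 e), (fun a => (K a).+2).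
split; first by do 2!apply: pbound_S.
move=> a; split; first by have := mf a; lia.
by move=> s /h[ev ec]; apply: reach_assign; [lia | rewrite updE eqxx].
Qed.

Lemma polytime_if (B : Type) {EB : Enc B} (b : A -> bool) (f g : A -> B) :
  polytime b -> polytime f -> polytime g -> polytime (fun a => if b a then f a else g a).
Proof.
move=> [q [U [hU hq]]] [p [T [hT hp]]] [r [V [hV hr]]].
(* The three programs leave the variables from [N] on untouched, so the input survives there. *)
pose N := maxn 1 (maxn (cmd_bound q) (maxn (cmd_bound p) (cmd_bound r))).
exists (Seq (Assign N (EVar 0)) (Seq q
  (If (EVar 0) (Seq (Assign 0 (EVar N)) p) (Seq (Assign 0 (EVar N)) r)))).
exists (fun a => (meas a + meas a + (U a + U a + T a + V a) + 20)); split.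
  by repeat apply: pbound_add => //; try exact: pbound_meas; exact: pbound_const.
move=> a; have [mb hqa] := hq a; have [mf hpa] := hp a; have [mg hra] := hr a.
split; first by case: (b a); lia.
have ma := @meas_ge _ EA a.
have mba : tsize (enc_bool (b a)) <= U a := mb.
move=> s s0.
have N0 : (0 == N) = false by rewrite /N; lia.
apply: (reach_seq (T1 := (meas a).+2)
  (P1 := fun s1 => s1 0 = enc a /\ s1 N = enc a)); last first.
- move=> s1 _ [h0 hN].
  apply: (reach_seq (hqa s1 h0)); last first.
    move=> s2 fr2 h2.
    apply: (reach_if (T1 := (meas a + T a + V a + 5))); last first.
      rewrite /= h2 /=.
      have hN2 : s2 N = enc a by rewrite fr2 // /N; lia.
      case: (b a) => /=.
        apply: (reach_seq (T1 := (meas a).+2) (P1 := fun s3 => s3 0 = enc a)).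
        - by apply: reach_assign => /=; [rewrite hN2 addn0; lia | rewrite updE hN2].
        - instantiate (1 := T a); lia.
        - by move=> s3 _ h3; exact: hpa.
      apply: (reach_seq (T1 := (meas a).+2) (P1 := fun s3 => s3 0 = enc a)).
      - by apply: reach_assign => /=; [rewrite hN2 addn0; lia | rewrite updE hN2].
      - instantiate (1 := V a); lia.
      - by move=> s3 _ h3; exact: hra.
    rewrite /= h2 addn0 /=; instantiate (1 := (U a + meas a + T a + V a + 10)); lia.
  instantiate (1 := (U a + U a + meas a + T a + V a + 12)); lia.
- by lia.
- apply: reach_assign; first by rewrite /= s0; lia.
  by rewrite !updE eqxx N0 /= s0.
Qed.

End PolytimeClosure.

Ltac pbound_tac := repeat match goal with
  | |- pbound (fun _ => ?n) => exact: pbound_const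
  | |- pbound (fun a => meas a) => exact: pbound_meas
  | |- pbound _ => assumption
  | |- pbound (fun a => @?T a + @?U a) => apply: (@pbound_add _ _ T U)
  | |- pbound (fun a => @?T a * @?U a) => apply: (@pbound_mul _ _ T U)
  | |- pbound (fun a => @?T a ^ ?n) => apply: (@pbound_exp _ _ T n)
  | |- pbound (fun a => (@?T a).+1) => apply: (@pbound_S _ _ T)
  end.

Lemma reach_assign_seq i e c s T1 T (P : store -> Prop) :
  ecost s e + T1 + 2 <= T -> reach c (upd s i (eval s e)) T1 P ->
  reach (Seq (Assign i e) c) s T P.
Proof.
move=> le h; apply: (reach_seq (T1 := (ecost s e).+1) (T2 := T1)
  (P1 := fun s1 => s1 = upd s i (eval s e))); [by apply: reach_assign | lia |].
by move=> s1 _ ->.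
Qed.

Section PolytimeClosure.
Context (A : Type) {EA : Enc A}.

Lemma polytime_pair (B C : Type) {EB : Enc B} {EC : Enc C} (f : A -> B) (g : A -> C) :
  polytime f -> polytime g -> polytime (fun a => (f a, g a)).
Proof.
move=> [p [U [hU hp]]] [q [V [hV hq]]].
pose N := maxn 1 (maxn (cmd_bound p) (cmd_bound q)).
exists (Seq (Assign N (EVar 0)) (Seq p (Seq (Assign N.+1 (EVar 0))
  (Seq (Assign 0 (EVar N)) (Seq q (Assign 0 (ENode (EVar N.+1) (EVar 0)))))))).
exists (fun a => (meas a + meas a + (U a + U a + U a + U a + V a + V a + V a) + 20)); split.
  by repeat apply: pbound_add => //; try exact: pbound_meas; exact: pbound_const.
move=> a; have [mf hpa] := hp a; have [mg hqa] := hq a; split=> /=; first lia.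
move=> s s0; have ma := @meas_ge _ EA a; have mfa := @meas_ge _ EB (f a).
have mga := @meas_ge _ EC (g a).
have N0 : (0 == N) = false by rewrite /N; lia.
have N1 : (0 == N.+1) = false by [].
have NS : (N == N.+1) = false by lia.
apply: (reach_assign_seq (T1 := (meas a + (U a + U a + U a + U a + V a + V a + V a) + 16))).
  by rewrite /= s0; lia.
apply: (reach_seq (T2 := (meas a + (U a + U a + U a + V a + V a + V a) + 14)) (hpa _ _)).
- by rewrite updE N0.
- lia.
move=> s1 fr1 h1; have hN : s1 N = enc a by rewrite fr1 ?updE ?eqxx // /N; lia.
apply: (reach_assign_seq (T1 := (meas a + (U a + U a + V a + V a + V a) + 12))).
  by rewrite /= h1; lia.
apply: (reach_assign_seq (T1 := (U a + U a + V a + V a + V a + 10))).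
  by rewrite /= updE NS hN; lia.
apply: (reach_seq (T2 := (U a + V a + V a + U a + 8)) (hqa _ _)).
- by rewrite updE eqxx /= updE NS.
- lia.
move=> s2 fr2 h2; have hN1 : s2 N.+1 = enc (f a).
  by rewrite fr2 ?updE ?eqxx ?h1 // /N; lia.
by apply: reach_assign; rewrite /= ?updE ?eqxx h2 hN1 //; lia.
Qed.

(** The bound [G] on intermediate results is essential: iterating a polynomial-time step may build
    exponentially large data. Loops enter all later programs through this lemma. *)
Lemma polytime_foldl (B C : Type) {EB : Enc B} {EC : Enc C}
    (l : A -> seq C) (z : A -> B) (f : A -> B -> C -> B) (G : A -> nat) :
  pbound G -> polytime l -> polytime z ->
  polytime (fun x : A * (B * C) => f x.1 x.2.1 x.2.2) ->
  (forall a n, meas (foldl (f a) (z a) (take n (l a))) <= G a) ->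
  polytime (fun a => foldl (f a) (z a) (l a)).
Proof.
move=> hG [p [U [hU hp]]] [q [V [hV hq]]] [r [W [[c hW] hr]]] bnd.
(* The variable [N] holds [a], [N.+1] the rest of the list and [N.+2] the accumulator. *)
pose N := maxn 1 (maxn (cmd_bound p) (maxn (cmd_bound q) (cmd_bound r))).
pose body := Seq (Assign 0 (ENode (EVar N) (ENode (EVar N.+2) (ELeft (EVar N.+1)))))
  (Seq r (Seq (Assign N.+2 (EVar 0)) (Assign N.+1 (ERight (EVar N.+1))))).
exists (Seq (Assign N (EVar 0)) (Seq p (Seq (Assign N.+1 (EVar 0))
  (Seq (Assign 0 (EVar N)) (Seq q (Seq (Assign N.+2 (EVar 0))
  (Seq (While (EVar N.+1) body) (Assign 0 (EVar N.+2))))))))).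
pose S a := @meas A EA a + G a + U a + 4.
(* The cost of one round: the step works on a triple of measure below [S a], hence within time
   [S a ^ c]. *)
pose K a := 20 * S a + 4 * S a ^ c.
pose R a := K a * (U a).+1.
exists (fun a => R a + 10 * S a + 2 * V a + 40); split.
  by rewrite /R /K /S; pbound_tac.
move=> a; have [ml hpa] := hp a; have [mz hqa] := hq a.
have bnda := bnd a.
have eS : S a = @meas A EA a + G a + U a + 4 by [].
have eK : K a = 20 * S a + 4 * S a ^ c by [].
have szl (s : seq C) : size s <= meas_seq s by elim: s => //= x s; lia.
split.
  by have := bnda (size (l a)); rewrite take_size; lia.
move=> s s0; have ma := @meas_ge _ EA a.
have mla := @meas_ge _ (Enc_seq EC) (l a).
have N0 : (0 == N) = false by rewrite /N; lia.
have N1 : (0 == N.+1) = false by [].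
have N2 : (0 == N.+2) = false by [].
have NS : (N == N.+1) = false by lia.
have NSS : (N == N.+2) = false by lia.
have S12 : (N.+1 == N.+2) = false by lia.
have S21 : (N.+2 == N.+1) = false by lia.
have loop : forall k s1, k <= size (l a) ->
    s1 N = enc a -> s1 N.+1 = enc (drop k (l a)) ->
    s1 N.+2 = enc (foldl (f a) (z a) (take k (l a))) ->
    reach (While (EVar N.+1) body) s1 (K a * (size (l a) - k).+1)
      (fun s2 => s2 N.+2 = enc (foldl (f a) (z a) (l a))).
  move=> k s1 kl; move En : (size (l a) - k) => n.
  elim: n k s1 kl En => [|n IH] k s1 kl En hN hN1 hN2.
    have ek : k = size (l a) by lia.
    exists (ecost s1 (EVar N.+1)).+1, s1; split.
    - by apply: ExecWhileEnd; rewrite /= hN1 ek drop_size.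
    - by rewrite /= hN1 ek drop_size /= ?eK; lia.
    - by rewrite hN2 ek take_size.
  have lt : k < size (l a) by lia.
  have [x0 [dr tk]] : exists x0, drop k (l a) = x0 :: drop k.+1 (l a) /\
      take k.+1 (l a) = rcons (take k (l a)) x0.
    have x0 : C by case: (l a) lt.
    by exists (nth x0 (l a) k); rewrite -(drop_nth x0) // -take_nth.
  pose b := foldl (f a) (z a) (take k (l a)).
  have eb : foldl (f a) (z a) (take k.+1 (l a)) = f a b x0.
    by rewrite tk -cats1 foldl_cat.
  have mb : meas b <= G a := bnda k.
  have mdr : meas_seq (drop k (l a)) <= U a.
    apply: leq_trans ml; rewrite -{2}(cat_take_drop k (l a)).
    by elim: (take k (l a)) => //= y t IHt; apply: leq_trans IHt _; lia.
  have mx : meas x0 < U a by move: mdr; rewrite dr /=; lia.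
  have tdr : tsize (enc (drop k (l a))) <= U a by apply: leq_trans (@meas_ge _ (Enc_seq EC) _) mdr.
  have [mr hra] := hr (a, (b, x0)).
  have Wle : W (a, (b, x0)) <= S a ^ c.
    apply: leq_trans (hW _) _; case: (c) => // c'; rewrite leq_exp2r //=; lia.
  have tb : tsize (enc b) <= G a := leq_trans (@meas_ge _ EB _) mb.
  have tx : tsize (enc x0) <= U a := leq_trans (@meas_ge _ EC _) (ltnW mx).
  have [t [s' [ex le [h'N [h'N1 h'N2]]]]] :
      reach body s1 (15 * S a + 3 * S a ^ c) (fun s2 => s2 N = enc a /\
        s2 N.+1 = enc (drop k.+1 (l a)) /\ s2 N.+2 = enc (f a b x0)).
    apply: (reach_assign_seq (T1 := (5 * S a + 3 * S a ^ c))).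
      by rewrite /= hN hN2 hN1 -/b; move: tdr; rewrite dr /=; lia.
    apply: (reach_seq (T2 := 4 * S a + 2 * S a ^ c) (hra _ _)).
    - by rewrite updE eqxx /= hN hN2 hN1 dr.
    - by lia.
    move=> s2 fr2 h2.
    have g0 : s2 N = enc a by rewrite fr2 ?updE ?(eq_sym N) ?N0 // /N; lia.
    have g1 : s2 N.+1 = enc (drop k (l a)) by rewrite fr2 ?updE //= /N; lia.
    have tW : tsize (enc (f a b x0)) <= S a ^ c.
      by apply: leq_trans (@meas_ge _ EB _) _; apply: leq_trans mr _.
    apply: (reach_assign_seq (T1 := 3 * S a + S a ^ c)); first by rewrite /= h2 /=; lia.
    apply: reach_assign.
      by rewrite /= updE S12 g1; move: tdr; rewrite dr /=; lia.
    by rewrite /= !updE ?eqxx ?NSS ?NS ?S12 ?S21 /= ?updE ?S12 ?g1 h2 dr g0.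
  have [t2 [s2 [ex2 le2 fin]]] := IH k.+1 s' ltac:(lia) ltac:(lia) h'N h'N1
    ltac:(by rewrite eb).
  exists (ecost s1 (EVar N.+1) + t + t2).+1, s2; split=> //.
    by apply: ExecWhileStep ex ex2; rewrite /= hN1 dr.
  move: tdr; rewrite /= hN1 /=.
  rewrite [K a * n.+2]mulnS; move: le le2; lia.
apply: (reach_assign_seq (T1 := R a + 9 * S a + 2 * V a + 37)).
  by rewrite /= s0; lia.
apply: (reach_seq (T2 := (R a + 8 * S a + 2 * V a + 36)) (hpa _ _)).
- by rewrite updE N0.
- by lia.
move=> s1 fr1 h1; have hN : s1 N = enc a by rewrite fr1 ?updE ?eqxx // /N; lia.
apply: (reach_assign_seq (T1 := (R a + 7 * S a + 2 * V a + 34))).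
  by rewrite /= h1; lia.
apply: (reach_assign_seq (T1 := (R a + 6 * S a + 2 * V a + 30))).
  by rewrite /= updE NS hN; lia.
apply: (reach_seq (T2 := (R a + 5 * S a + V a + 28)) (hqa _ _)).
- by rewrite updE eqxx /= updE NS.
- by lia.
move=> s2 fr2 h2.
have hN1 : s2 N.+1 = enc (l a) by rewrite fr2 ?updE ?eqxx ?h1 //= /N; lia.
have hN' : s2 N = enc a.
  by rewrite fr2 ?updE ?NS ?(eq_sym N) ?N0 //= /N; lia.
have mz' := leq_trans (@meas_ge _ EB (z a)) mz.
apply: (reach_assign_seq (T1 := (R a + 4 * S a + 26))).
  by rewrite /= h2; lia.
have ul : size (l a) <= U a by apply: leq_trans (szl _) ml.
apply: (reach_seq (T1 := R a) (T2 := 4 * S a + 20)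
  (P1 := fun s2 => s2 N.+2 = enc (foldl (f a) (z a) (l a)))).
- have [||||t [s' [ex le h]]] := loop 0 (upd s2 N.+2 (eval s2 (EVar 0))).
  + by [].
  + by rewrite updE NSS.
  + by rewrite updE S12 drop0.
  + by rewrite updE eqxx take0.
  exists t, s'; split=> //; apply: leq_trans le _.
  by rewrite subn0 leq_mul2l ltnS ul orbT.
- by lia.
move=> s3 _ h3; apply: reach_assign; last by rewrite updE eqxx.
rewrite /= h3; have := bnda (size (l a)); rewrite take_size.
by have := @meas_ge _ EB (foldl (f a) (z a) (l a)); lia.
Qed.

End PolytimeClosure.

(** * Primitive operations on pairs, lists and numbers *)

Fixpoint tree_expr (x : tree) : expr :=
  if x is Node l r then ENode (tree_expr l) (tree_expr r) else ELeaf.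

Lemma eval_tree_expr s x : eval s (tree_expr x) = x.
Proof. by elim: x => //= l -> r ->. Qed.

Lemma ecost_tree_expr s r x : ecost s (tree_expr x) = ecost r (tree_expr x).
Proof. by elim: x => //= x1 -> x2 ->; rewrite !eval_tree_expr. Qed.

Lemma tsize_enc_nat n : tsize (enc_nat n) = n * 2 + 1.
Proof. by elim: n => //= n; lia. Qed.

Lemma size_le_meas (A : Type) {EA : Enc A} (s : seq A) : size s <= meas s.
Proof. by elim: s => //= x s; lia. Qed.

Lemma meas_seq_cat (A : Type) {EA : Enc A} (s t : seq A) :
  meas_seq (s ++ t) + 1 = meas_seq s + meas_seq t.
Proof. by elim: s => [|x s IH] /=; lia. Qed.

Lemma meas_seq_le (A : Type) {EA : Enc A} (s : seq A) n m :
  size s <= n -> (forall i x0, i < size s -> meas (nth x0 s i) <= m) ->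
  meas_seq s <= n * m.+1 + 1.
Proof.
elim: s n => [|x s IH] n //= sn h; first lia.
case: n sn => // n sn; have := IH n sn (fun i x0 => h i.+1 x0).
by have := h 0 x isT; rewrite /= mulSn; lia.
Qed.

Section Primitives.
Context (A : Type) {EA : Enc A}.

Lemma polytime_const (B : Type) {EB : Enc B} (b : B) : polytime (fun _ : A => b).
Proof.
apply: (polytime_expr (e := tree_expr (enc b))
  (K := fun=> meas b + ecost (fun=> Leaf) (tree_expr (enc b)))).
- exact: pbound_const.
- by move=> _; exact: leq_addr.
- move=> _ s _; rewrite eval_tree_expr; split=> //.
  by rewrite (ecost_tree_expr s (fun=> Leaf)) leq_addl.
Qed.

Lemma polytime_fst (B C : Type) {EB : Enc B} {EC : Enc C} (f : A -> B * C) :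
  polytime f -> polytime (fun a => (f a).1).
Proof.
apply: (@polytime_comp A EA _ _ _ _ fst f).
apply: (polytime_expr (e := ELeft (EVar 0)) (K := fun x => meas x + meas x + 1)).
- by pbound_tac.
- by move=> [b c] /=; lia.
- move=> [b c] s /= ->; have := @meas_ge _ EB b; have := @meas_ge _ EC c.
  by split=> //=; lia.
Qed.

Lemma polytime_snd (B C : Type) {EB : Enc B} {EC : Enc C} (f : A -> B * C) :
  polytime f -> polytime (fun a => (f a).2).
Proof.
apply: (@polytime_comp A EA _ _ _ _ snd f).
apply: (polytime_expr (e := ERight (EVar 0)) (K := fun x => meas x + meas x + 1)).
- by pbound_tac.
- by move=> [b c] /=; lia.
- move=> [b c] s /= ->; have := @meas_ge _ EB b; have := @meas_ge _ EC c.
  by split=> //=; lia.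
Qed.

(** A nonempty list is encoded as the pair of its head and tail, and a unary number as a list of
    units, so these conversions leave the tree unchanged and arithmetic reduces to lists. *)
Lemma polytime_same_enc (B C : Type) {EB : Enc B} {EC : Enc C} (f : A -> B) (g : B -> C) :
  (forall b, enc (g b) = enc b) -> (forall b, meas (g b) <= meas b) ->
  polytime f -> polytime (fun a => g (f a)).
Proof.
move=> eg mg; apply: polytime_comp.
apply: (polytime_expr (e := EVar 0) (K := fun x => meas x)) => //.
- exact: pbound_meas.
- by move=> b s /= ->; rewrite eg addn0 meas_ge.
Qed.

Lemma polytime_cons (B : Type) {EB : Enc B} (f : A -> B) (g : A -> seq B) :
  polytime f -> polytime g -> polytime (fun a => f a :: g a).
Proof.
move=> hf hg.
exact: (polytime_same_enc (g := fun x : B * seq B => x.1 :: x.2)) (polytime_pair hf hg).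
Qed.

Lemma polytime_behead (B : Type) {EB : Enc B} (f : A -> seq B) :
  polytime f -> polytime (fun a => behead (f a)).
Proof.
apply: (@polytime_comp A EA _ _ _ _ behead f).
apply: (polytime_expr (e := ERight (EVar 0)) (K := fun x => meas x + meas x + 1)).
- by pbound_tac.
- by move=> [|x s] /=; lia.
- move=> [|x s] r /= -> //; have := @meas_ge _ EB x.
  by have := @meas_ge _ (Enc_seq EB) s; split=> //=; move: H => /=; lia.
Qed.

Lemma polytime_nilp (B : Type) {EB : Enc B} (f : A -> seq B) :
  polytime f -> polytime (fun a => nilp (f a)).
Proof.
apply: (@polytime_comp A EA _ _ _ _ (@nilp B) f).
exists (If (EVar 0) (Assign 0 ELeaf) (Assign 0 (ENode ELeaf ELeaf))).
exists (fun x => meas x + 20); split; first by pbound_tac.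
move=> [|x s] /=; split; try lia.
  move=> s0 e; apply: (reach_if (T1 := 10)) => /=; rewrite e //=.
  by apply: reach_assign.
move=> s0 e; apply: (reach_if (T1 := 5)) => /=; rewrite e /=.
  have := @meas_ge _ EB x; have := @meas_ge _ (Enc_seq EB) s => /=; lia.
by apply: reach_assign.
Qed.

Lemma polytime_nseq (f : A -> nat) : polytime f -> polytime (fun a => nseq (f a) tt).
Proof.
apply: (polytime_same_enc (g := fun n => nseq n tt)).
  by elim=> //= n ->.
by elim=> //= n; lia.
Qed.

Lemma polytime_size_unit (f : A -> seq unit) : polytime f -> polytime (fun a => size (f a)).
Proof.
apply: (polytime_same_enc (g := @size unit)).
  by elim=> [|[] s] //= ->.
by elim=> [|[] s] //=; lia.
Qed.

Lemma polytime_negb f : polytime f -> polytime (fun a : A => ~~ f a).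
Proof.
move=> hf; apply: (polytime_ext (f := fun a => if f a then false else true)).
  by move=> a; case: (f a).
by apply: polytime_if => //; exact: polytime_const.
Qed.

Lemma polytime_andb f g : polytime f -> polytime g -> polytime (fun a : A => f a && g a).
Proof.
move=> hf hg; apply: (polytime_ext (f := fun a => if f a then g a else false)).
  by move=> a; case: (f a).
by apply: polytime_if => //; exact: polytime_const.
Qed.

Lemma polytime_orb f g : polytime f -> polytime g -> polytime (fun a : A => f a || g a).
Proof.
move=> hf hg; apply: (polytime_ext (f := fun a => if f a then true else g a)).
  by move=> a; case: (f a).
by apply: polytime_if => //; exact: polytime_const.
Qed.

End Primitives.

Lemma polytime_fst_id (B C : Type) {EB : Enc B} {EC : Enc C} :
  polytime (fun x : B * C => x.1).
Proof. by apply: polytime_fst; exact: polytime_id. Qed.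

Lemma polytime_snd_id (B C : Type) {EB : Enc B} {EC : Enc C} :
  polytime (fun x : B * C => x.2).
Proof. by apply: polytime_snd; exact: polytime_id. Qed.

Lemma polytime_meas (A B : Type) {EA : Enc A} {EB : Enc B} (f : A -> B) :
  polytime f -> pbound (fun a => meas (f a)).
Proof. by move=> [p [T [hT h]]]; apply: (pbound_le hT) => a; case: (h a). Qed.

Ltac ptime_hook := fail.

Ltac ptime1 := lazymatch goal with
  | |- polytime (fun _ => ?c) => exact: polytime_const
  | |- polytime fst => exact: polytime_fst_id
  | |- polytime snd => exact: polytime_snd_id
  | |- polytime (fun x => x) => exact: polytime_id
  | |- polytime (fun x => (_, _)) => apply: polytime_pair
  | |- polytime (fun x => fst _) => apply: polytime_fst
  | |- polytime (fun x => snd _) => apply: polytime_snd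
  | |- polytime (fun x => _ :: _) => apply: polytime_cons
  | |- polytime (fun x => behead _) => apply: polytime_behead
  | |- polytime (fun x => nilp _) => apply: polytime_nilp
  | |- polytime (fun x => if _ then _ else _) => apply: polytime_if
  | |- polytime (fun x => ~~ _) => apply: polytime_negb
  | |- polytime (fun x => _ && _) => apply: polytime_andb
  | |- polytime (fun x => _ || _) => apply: polytime_orb
  | |- _ => ptime_hook
  end.
Ltac ptime_hyp := match goal with
  | H : polytime ?h |- polytime (fun x => ?h (@?a x)) => apply: (polytime_comp (f := a) H)
  end.
Ltac ptime := repeat (cbv beta; first [assumption | ptime_hyp | ptime1]).

Lemma meas_seq_gt0 (A : Type) {EA : Enc A} (s : seq A) : 0 < meas_seq s.
Proof. by case: s. Qed.

Lemma meas_seq_take_drop (A : Type) {EA : Enc A} (s : seq A) n :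
  meas_seq (take n s) <= meas_seq s /\ meas_seq (drop n s) <= meas_seq s.
Proof.
have := @meas_seq_cat _ EA (take n s) (drop n s); rewrite cat_take_drop.
by have := @meas_seq_gt0 _ EA (take n s); have := @meas_seq_gt0 _ EA (drop n s); lia.
Qed.

Lemma meas_seq_rev (A : Type) {EA : Enc A} (s : seq A) : meas_seq (rev s) = meas_seq s.
Proof.
elim: s => // x s IH; rewrite rev_cons -cats1.
by have := @meas_seq_cat _ EA (rev s) [:: x] => /=; lia.
Qed.

Lemma meas_seq_flatten (A : Type) {EA : Enc A} (s : seq (seq A)) :
  meas_seq (flatten s) <= meas_seq s.
Proof. by elim: s => //= x s IH; have := @meas_seq_cat _ EA x (flatten s); lia. Qed.

Lemma polytime_catrev (A B : Type) {EA : Enc A} {EB : Enc B} (f g : A -> seq B) :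
  polytime f -> polytime g -> polytime (fun a => catrev (f a) (g a)).
Proof.
move=> hf hg; apply: (polytime_ext
  (f := fun a => foldl (fun s x => x :: s) (g a) (f a))).
  by move=> a; elim: (f a) (g a) => //= x s IH t; rewrite IH.
have mf := polytime_meas hf; have mg := polytime_meas hg.
apply: (polytime_foldl (G := fun a => meas (f a) + meas (g a)) (f := fun _ s x => x :: s)) => //.
- by pbound_tac.
- by ptime.
- move=> a n /=; have := (@meas_seq_take_drop _ EB (f a) n).1; move: (take n (f a)) => s.
  elim: s (g a) (meas_seq (f a)) => /= [|x s IH] t m; first lia.
  by move=> h; have := IH (x :: t) (m - (@meas _ EB x).+1) => /=; lia.
Qed.

Lemma polytime_rev (A B : Type) {EA : Enc A} {EB : Enc B} (f : A -> seq B) :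
  polytime f -> polytime (fun a => rev (f a)).
Proof. by move=> hf; apply: polytime_catrev => //; exact: polytime_const. Qed.

Lemma polytime_cat (A B : Type) {EA : Enc A} {EB : Enc B} (f g : A -> seq B) :
  polytime f -> polytime g -> polytime (fun a => f a ++ g a).
Proof.
move=> hf hg; apply: (polytime_ext (f := fun a => catrev (rev (f a)) (g a))).
  by move=> a; rewrite catrevE revK.
by apply: polytime_catrev => //; exact: polytime_rev.
Qed.

Lemma polytime_map (A B C : Type) {EA : Enc A} {EB : Enc B} {EC : Enc C}
    (l : A -> seq B) (f : A -> B -> C) :
  polytime l -> polytime (fun x : A * B => f x.1 x.2) ->
  polytime (fun a => [seq f a x | x <- l a]).
Proof.
move=> hl hf; apply: (polytime_ext
  (f := fun a => rev (foldl (fun s x => f a x :: s) [::] (l a)))).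
  move=> a; suff E t : foldl (fun s x => f a x :: s) t (l a) =
      catrev [seq f a x | x <- l a] t by rewrite E -[LHS]/(rev (rev _)) revK.
  by elim: (l a) t => //= x s IH t; rewrite IH.
apply: polytime_rev.
have ml := polytime_meas hl.
have [p [T [[c hT] h]]] := hf.
pose G a := @meas _ (Enc_seq EB) (l a) *
  ((@meas _ EA a + @meas _ (Enc_seq EB) (l a) + 3) ^ c).+1 + 1.
apply: (polytime_foldl (G := G) (f := fun a s x => f a x :: s)) => //.
- by rewrite /G; pbound_tac.
- exact: polytime_const.
- apply: polytime_cons; last by ptime.
  apply: (@polytime_comp _ _ _ _ _ _ (fun x : A * B => f x.1 x.2)
    (fun x : A * (seq C * B) => (x.1, x.2.2))) => //; ptime.
- move=> a n /=.
  have -> : foldl (fun s x => f a x :: s) [::] (take n (l a)) =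
      rev [seq f a x | x <- take n (l a)].
    suff E s t : foldl (fun s x => f a x :: s) t s =
      catrev [seq f a x | x <- s] t by rewrite E.
    by elim: s t => //= x s IH t; rewrite IH.
  rewrite meas_seq_rev; apply: meas_seq_le.
    rewrite size_map size_take; have := @size_le_meas _ EB (l a) => /=; case: ifP; lia.
  move=> i x0; rewrite size_map => lt.
  have x1 : B by case: (take n (l a)) lt.
  rewrite (nth_map x1) //.
  have mx : meas (nth x1 (take n (l a)) i) <= meas_seq (l a).
    apply: leq_trans (meas_seq_take_drop (l a) n).1.
    by elim: (take n (l a)) i lt => //= y s IH [|i] /= lt; [lia | have := IH i lt; lia].
  have [+ _] := h (a, nth x1 (take n (l a)) i) => /= h1.
  apply: leq_trans h1 _; apply: leq_trans (hT _) _ => /=.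
  by case: (c) => // c'; rewrite leq_exp2r //=; lia.
Qed.

Lemma foldl_cat_flatten (B : Type) (s : seq (seq B)) t :
  foldl (@cat B) t s = t ++ flatten s.
Proof. by elim: s t => [|x s IH] t /=; rewrite ?cats0 // IH catA. Qed.

Lemma polytime_flatten (A B : Type) {EA : Enc A} {EB : Enc B} (f : A -> seq (seq B)) :
  polytime f -> polytime (fun a => flatten (f a)).
Proof.
move=> hf; apply: (polytime_ext (f := fun a => foldl (@cat B) [::] (f a))).
  by move=> a; rewrite foldl_cat_flatten.
have mf := polytime_meas hf.
apply: (polytime_foldl (G := fun a => meas (f a)) (f := fun _ => @cat B)) => //.
- exact: polytime_const.
- by cbv beta; apply: polytime_cat; ptime.
- move=> a n /=; apply: leq_trans (meas_seq_take_drop (f a) n).1.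
  by rewrite foldl_cat_flatten meas_seq_flatten.
Qed.

Lemma polytime_filter (A B : Type) {EA : Enc A} {EB : Enc B} (l : A -> seq B) (p : A -> B -> bool) :
  polytime l -> polytime (fun x : A * B => p x.1 x.2) ->
  polytime (fun a => [seq x <- l a | p a x]).
Proof.
move=> hl hp; apply: (polytime_ext
  (f := fun a => flatten [seq if p a x then [:: x] else [::] | x <- l a])).
  by move=> a; elim: (l a) => //= x s ->; case: (p a x).
apply: polytime_flatten; apply: (polytime_map (f := fun a x => if p a x then [:: x] else [::])) => //.
by apply: polytime_if; ptime.
Qed.

Lemma polytime_all (A B : Type) {EA : Enc A} {EB : Enc B} (l : A -> seq B) (p : A -> B -> bool) :
  polytime l -> polytime (fun x : A * B => p x.1 x.2) ->
  polytime (fun a => all (p a) (l a)).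
Proof.
move=> hl hp; apply: (polytime_ext
  (f := fun a => nilp [seq x <- l a | ~~ p a x])).
  by move=> a; elim: (l a) => //= x s <-; case: (p a x).
apply: polytime_nilp; apply: (polytime_filter (p := fun a x => ~~ p a x)) => //.
by ptime.
Qed.

Lemma polytime_has (A B : Type) {EA : Enc A} {EB : Enc B} (l : A -> seq B) (p : A -> B -> bool) :
  polytime l -> polytime (fun x : A * B => p x.1 x.2) ->
  polytime (fun a => has (p a) (l a)).
Proof.
move=> hl hp; apply: (polytime_ext (f := fun a => ~~ nilp [seq x <- l a | p a x])).
  by move=> a; elim: (l a) => //= x s <-; case: (p a x).
by apply: polytime_negb; apply: polytime_nilp; apply: polytime_filter.
Qed.

Lemma polytime_size (A B : Type) {EA : Enc A} {EB : Enc B} (l : A -> seq B) :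
  polytime l -> polytime (fun a => size (l a)).
Proof.
move=> hl; apply: (polytime_ext (f := fun a => size [seq tt | _ <- l a])).
  by move=> a; rewrite size_map.
apply: polytime_size_unit; apply: polytime_map => //; exact: polytime_const.
Qed.

Lemma polytime_count (A B : Type) {EA : Enc A} {EB : Enc B} (l : A -> seq B) (p : A -> B -> bool) :
  polytime l -> polytime (fun x : A * B => p x.1 x.2) ->
  polytime (fun a => count (p a) (l a)).
Proof.
move=> hl hp; apply: (polytime_ext (f := fun a => size [seq x <- l a | p a x])).
  by move=> a; rewrite size_filter.
by apply: polytime_size; apply: polytime_filter.
Qed.

Lemma polytime_addn (A : Type) {EA : Enc A} (f g : A -> nat) : polytime f -> polytime g -> polytime (fun a => f a + g a).
Proof.
move=> hf hg; apply: (polytime_ext (f := fun a => size (nseq (f a) tt ++ nseq (g a) tt))).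
  by move=> a; rewrite size_cat !size_nseq.
by apply: polytime_size; apply: polytime_cat; apply: polytime_nseq.
Qed.

Lemma polytime_succn (A : Type) {EA : Enc A} (f : A -> nat) : polytime f -> polytime (fun a => (f a).+1).
Proof.
move=> hf; apply: (polytime_ext (f := fun a => f a + 1)); first by move=> a; rewrite addn1.
by apply: polytime_addn => //; exact: polytime_const.
Qed.

Lemma polytime_predn (A : Type) {EA : Enc A} (f : A -> nat) : polytime f -> polytime (fun a => (f a).-1).
Proof.
move=> hf; apply: (polytime_ext (f := fun a => size (behead (nseq (f a) tt)))).
  by move=> a; rewrite size_behead size_nseq.
by apply: polytime_size; apply: polytime_behead; apply: polytime_nseq.
Qed.

Lemma polytime_drop (A B : Type) {EA : Enc A} {EB : Enc B} (l : A -> seq B) (n : A -> nat) :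
  polytime l -> polytime n -> polytime (fun a => drop (n a) (l a)).
Proof.
move=> hl hn; apply: (polytime_ext
  (f := fun a => foldl (fun s _ => behead s) (l a) (nseq (n a) tt))).
  by move=> a; elim: (n a) (l a) => [|k IH] [|x s] //=; rewrite IH.
have ml := polytime_meas hl.
apply: (polytime_foldl (G := fun a => meas (l a)) (f := fun _ s (_ : unit) => behead s)) => //.
- exact: polytime_nseq.
- by ptime.
- move=> a k /=; elim: (take _ _) (l a) => //= _ s IH t; apply: leq_trans (IH _) _.
  by case: t => //= x t; lia.
Qed.

Lemma polytime_head (A B : Type) {EA : Enc A} {EB : Enc B} (l : A -> seq B) x0 :
  polytime l -> polytime (fun a => head x0 (l a)).
Proof.
move=> hl; apply: (polytime_ext (f := fun a => foldl (fun _ x => x) x0 (rev (l a)))).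
  by move=> a; case: (l a) => //= x s; rewrite rev_cons -cats1 foldl_cat.
have hr := polytime_rev hl; have ml := polytime_meas hl.
apply: (polytime_foldl (G := fun a => meas x0 + meas (l a)) (z := fun=> x0)
  (f := fun _ _ (x : B) => x)) => //.
- by pbound_tac.
- exact: polytime_const.
- by ptime.
- move=> a k /=; rewrite -(meas_seq_rev (l a)).
  apply: leq_trans _ (leq_add (leqnn _) (meas_seq_take_drop _ k).1).
  elim/last_ind: (take _ _) => /= [|s x IH]; first by lia.
  rewrite -cats1 foldl_cat /=; have := @meas_seq_cat _ EB s [:: x] => /=.
  by have := @meas_seq_gt0 _ EB s; lia.
Qed.

Lemma polytime_nth (A B : Type) {EA : Enc A} {EB : Enc B} (l : A -> seq B) (n : A -> nat) x0 :
  polytime l -> polytime n -> polytime (fun a => nth x0 (l a) (n a)).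
Proof.
move=> hl hn; apply: (polytime_ext (f := fun a => head x0 (drop (n a) (l a)))).
  by move=> a; rewrite -nth0 nth_drop addn0.
by apply: polytime_head; apply: polytime_drop.
Qed.

Lemma polytime_subn (A : Type) {EA : Enc A} (f g : A -> nat) : polytime f -> polytime g -> polytime (fun a => f a - g a).
Proof.
move=> hf hg; apply: (polytime_ext (f := fun a => size (drop (g a) (nseq (f a) tt)))).
  by move=> a; rewrite size_drop size_nseq.
by apply: polytime_size; apply: polytime_drop => //; apply: polytime_nseq.
Qed.

Lemma polytime_leq (A : Type) {EA : Enc A} (f g : A -> nat) : polytime f -> polytime g -> polytime (fun a => f a <= g a).
Proof.
move=> hf hg; apply: (polytime_ext (f := fun a => nilp (nseq (f a - g a) tt))).
  by move=> a; rewrite /nilp size_nseq.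
by apply: polytime_nilp; apply: polytime_nseq; apply: polytime_subn.
Qed.

Lemma polytime_eqn (A : Type) {EA : Enc A} (f g : A -> nat) : polytime f -> polytime g -> polytime (fun a => f a == g a).
Proof.
move=> hf hg; apply: (polytime_ext (f := fun a => (f a <= g a) && (g a <= f a))).
  by move=> a; rewrite eqn_leq.
by apply: polytime_andb; apply: polytime_leq.
Qed.

Lemma polytime_eqb (A : Type) {EA : Enc A} (f g : A -> bool) : polytime f -> polytime g -> polytime (fun a => f a == g a :> bool).
Proof.
move=> hf hg; apply: (polytime_ext (f := fun a => if f a then g a else ~~ g a)).
  by move=> a; case: (f a); case: (g a).
by apply: polytime_if => //; apply: polytime_negb.
Qed.

Lemma polytime_muln (A : Type) {EA : Enc A} (f g : A -> nat) : polytime f -> polytime g -> polytime (fun a => f a * g a).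
Proof.
move=> hf hg; apply: (polytime_ext
  (f := fun a => size (flatten [seq nseq (g a) tt | _ <- nseq (f a) tt]))).
  by move=> a; elim: (f a) => //= n IH; rewrite size_cat IH size_nseq mulSn.
apply: polytime_size; apply: polytime_flatten.
apply: (polytime_map (f := fun a _ => nseq (g a) tt)); first exact: polytime_nseq.
by apply: polytime_nseq; apply: (polytime_comp hg); exact: polytime_fst_id.
Qed.

Lemma polytime_iota (A : Type) {EA : Enc A} (n : A -> nat) : polytime n -> polytime (fun a => iota 0 (n a)).
Proof.
move=> hn; apply: (polytime_ext
  (f := fun a => rev (foldl (fun s _ => size s :: s) [::] (nseq (n a) tt)))).
  move=> a.
  suff E m k : foldl (fun s _ => size s :: s) (rev (iota 0 m)) (nseq k tt) = rev (iota 0 (m + k)).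
    by rewrite (E 0) revK.
  elim: k m => [|k IH] m /=; first by rewrite addn0.
  by rewrite size_rev size_iota -(rev_rcons (iota 0 m)) -cats1 -(iotaD 0 m 1) IH addn1 addSnnS.
have mn := polytime_meas hn.
apply: polytime_rev; apply: (polytime_foldl (G := fun a => n a * ((n a) * 2 + 1).+1 + 1)
   (f := fun _ s (_ : unit) => size s :: s)).
- have mn' : pbound n by apply: (pbound_le mn) => a; rewrite [meas _]tsize_enc_nat; lia.
  by pbound_tac.
- exact: polytime_nseq.
- exact: polytime_const.
- by apply: polytime_cons; [apply: polytime_size|]; ptime.
- move=> a k /=; apply: meas_seq_le.
    suff E s t : size (foldl (fun (s : seq nat) (_ : unit) => size s :: s) s t) = size s + size t.
      by rewrite E size_take size_nseq /=; case: ifP; lia.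
    by elim: t s => [|x t IH] s /=; rewrite ?addn0 // IH /= addSnnS.
  move=> i x0.
  have tl : size (take k (nseq (n a) tt)) <= n a by rewrite size_take size_nseq; case: ifP; lia.
  move: (take _ _) tl => t tl.
  suff E s : all (fun x => x < size s + size t) s ->
    all (fun x => x < size s + size t) (foldl (fun (s : seq nat) (_ : unit) => size s :: s) s t).
    move=> lt; have /(all_nthP x0)/(_ i lt) := E [::] isT.
    by rewrite [meas _]tsize_enc_nat /=; lia.
  elim: t s {tl} => [|x t IH] s /= h; first by [].
  rewrite addnS -addSn; apply: (IH (size s :: s)); rewrite /= addSn leq_addr /=.
  by apply: sub_all h => y; rewrite addnS.
Qed.

(** * The reduction in polynomial time *)

#[export] Instance Enc_tree : Enc tree :=
  {| enc := id; meas := tsize; meas_ge := fun=> leqnn _ |}.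

Lemma polytime_reencode (A B C : Type) {EA : Enc A} {EB : Enc B} {EC : Enc C}
    (f : A -> B) (g : A -> C) :
  (forall a, enc (g a) = enc (f a)) -> (forall a, meas (g a) <= meas (f a)) ->
  polytime f -> polytime g.
Proof.
move=> eg mg [p [T [hT h]]]; exists p, T; split=> // a; have [h1 h2] := h a.
by split=> [|s]; [exact: leq_trans (mg a) h1 | rewrite eg; exact: h2].
Qed.

Lemma polytime_comp2 (A B C D : Type) {EA : Enc A} {EB : Enc B} {EC : Enc C} {ED : Enc D}
    (F : B -> C -> D) (f : A -> B) (g : A -> C) :
  polytime (fun x : B * C => F x.1 x.2) -> polytime f -> polytime g ->
  polytime (fun a => F (f a) (g a)).
Proof. by move=> hF hf hg; exact: (polytime_comp hF (polytime_pair hf hg)). Qed.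

Class EqPolytime (T : eqType) {ET : Enc T} : Prop :=
  eq_polytime : polytime (fun x : T * T => x.1 == x.2).
Arguments EqPolytime T {ET}.

Lemma polytime_eq (A : Type) (T : eqType) {EA : Enc A} {ET : Enc T} {QT : EqPolytime T}
    (f g : A -> T) :
  polytime f -> polytime g -> polytime (fun a => f a == g a).
Proof. by move=> hf hg; exact: (polytime_comp2 (F := fun x y => x == y) eq_polytime hf hg). Qed.

#[export] Instance EqPolytime_nat : EqPolytime nat.
Proof. by apply: polytime_eqn; ptime. Qed.

#[export] Instance EqPolytime_bool : EqPolytime bool.
Proof. by apply: polytime_eqb; ptime. Qed.

Ltac ptime_hook ::= lazymatch goal with
  | |- polytime size => refine (@polytime_size _ _ _ _ (fun s => s) _)
  | |- polytime (fun x => map _ _) => apply: polytime_map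
  | |- polytime (fun x => flatten _) => apply: polytime_flatten
  | |- polytime (fun x => filter _ _) => apply: polytime_filter
  | |- polytime (fun x => all _ _) => apply: polytime_all
  | |- polytime (fun x => has _ _) => apply: polytime_has
  | |- polytime (fun x => count _ _) => apply: polytime_count
  | |- polytime (fun x => size _) => apply: polytime_size
  | |- polytime (fun x => _ ++ _) => apply: polytime_cat
  | |- polytime (fun x => rev _) => apply: polytime_rev
  | |- polytime (fun x => nth _ _ _) => apply: polytime_nth
  | |- polytime (fun x => iota 0 _) => apply: polytime_iota
  | |- polytime (fun x => nseq _ tt) => apply: polytime_nseq
  | |- polytime (fun x => _ - _) => apply: polytime_subn
  | |- polytime (fun x => _ + _) => apply: polytime_addn
  | |- polytime (fun x => _ * _) => apply: polytime_muln
  | |- polytime (fun x => _ == _) => apply: polytime_eq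
  | |- polytime (fun x => leq _ _) => apply: polytime_leq
  | |- polytime (fun x => S _) => apply: polytime_succn
  | |- polytime (fun x => predn _) => apply: polytime_predn
  end.

#[export] Instance EqPolytime_pair (T U : eqType) {ET : Enc T} {EU : Enc U}
  {QT : EqPolytime T} {QU : EqPolytime U} : EqPolytime (T * U)%type.
Proof.
rewrite /EqPolytime.
apply: (polytime_ext (f := fun x : (T * U) * (T * U) => (x.1.1 == x.2.1) && (x.1.2 == x.2.2))).
  by move=> [[a b] [c d]].
by ptime.
Qed.

#[export] Instance EqPolytime_seq_nat : EqPolytime (seq nat).
Proof.
rewrite /EqPolytime.
apply: (polytime_ext (f := fun x : seq nat * seq nat => (size x.1 == size x.2) &&
    all (fun i => nth 0 x.1 i == nth 0 x.2 i) (iota 0 (size x.1)))); last by ptime.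
move=> [s t] /=; apply/andP/eqP => [[/eqP sz /allP h]|->].
  apply: (@eq_from_nth _ 0) => // i lt; apply/eqP/h.
  by rewrite mem_iota.
by split=> //; apply/allP.
Qed.

Lemma polytime_divn (A : Type) {EA : Enc A} (f g : A -> nat) :
  polytime f -> polytime g -> polytime (fun a => f a %/ g a).
Proof.
move=> hf hg; apply: (polytime_ext (f := fun a => if g a == 0 then 0 else
    count (fun i => i.+1 * g a <= f a) (iota 0 (f a)))); last by ptime.
move=> a; case: eqP => [->|/eqP]; rewrite ?divn0 // -lt0n => g0.
rewrite (@eq_count _ _ (fun i => i < f a %/ g a)); last by move=> i; rewrite leq_divRL.
rewrite -[X in iota 0 X](subnKC (leq_div (f a) (g a))) iotaD count_cat add0n.
rewrite (_ : count _ (iota 0 _) = f a %/ g a); last first.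
  rewrite -[RHS](size_iota 0); apply/eqP; rewrite -all_count; apply/allP => i.
  by rewrite mem_iota.
rewrite (_ : count _ (iota _ _) = 0) ?addn0 //; apply/eqP; rewrite -leqn0 leqNgt -has_count.
by apply/hasPn => i; rewrite mem_iota => /andP[h _]; rewrite -leqNgt.
Qed.

Lemma polytime_modn (A : Type) {EA : Enc A} (f g : A -> nat) :
  polytime f -> polytime g -> polytime (fun a => f a %% g a).
Proof.
move=> hf hg; apply: (polytime_ext (f := fun a => f a - f a %/ g a * g a)).
  by move=> a; rewrite {1}(divn_eq (f a) (g a)) addKn.
by have hd := polytime_divn hf hg; ptime.
Qed.

Lemma polytime_odd (A : Type) {EA : Enc A} (f : A -> nat) :
  polytime f -> polytime (fun a => odd (f a)).
Proof.
move=> hf; apply: (polytime_ext (f := fun a => f a %% 2 == 1)).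
  by move=> a; rewrite modn2; case: (odd _).
by apply: polytime_eq; [apply: polytime_modn => // |]; ptime.
Qed.

Lemma mask_nth (T : Type) (x0 : T) (b : bitseq) (s : seq T) :
  mask b s = [seq nth x0 s i | i <- [seq i <- iota 0 (size s) | nth false b i]].
Proof.
elim: b s => [|c b IH] [|x s] //=.
- by rewrite (eq_filter (a2 := pred0)) ?filter_pred0 // => -[].
- have e : [seq i <- iota 1 (size s) | nth false (c :: b) i] =
      map succn [seq i <- iota 0 (size s) | nth false b i].
    by rewrite -[1]/(1 + 0) iotaDl filter_map.
  by case: c e => /= ->; rewrite IH -map_comp.
Qed.

Lemma polytime_mask (A B : Type) {EA : Enc A} {EB : Enc B} (x0 : B)
    (f : A -> seq bool) (g : A -> seq B) :
  polytime f -> polytime g -> polytime (fun a => mask (f a) (g a)).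
Proof.
move=> hf hg; apply: (polytime_ext (f := fun a =>
    [seq nth x0 (g a) i | i <- [seq i <- iota 0 (size (g a)) | nth false (f a) i]])).
  by move=> a; rewrite -mask_nth.
by ptime.
Qed.

(** * Evaluating circuits and constraints in polynomial time *)

Definition gate_tag (g : gate) : nat :=
  match g with GInput => 0 | GNot _ => 1 | GAnd _ => 2 | GOr _ => 3 end.

Lemma polytime_gate_tag : polytime gate_tag.
Proof.
apply: (polytime_reencode (EB := Enc_tree) (f := fun g => tleft (enc g))); try by case.
apply: (polytime_expr (e := ELeft (EVar 0)) (K := fun x => meas x + meas x)).
- by pbound_tac.
- by case=> *; rewrite /=; lia.
- by case=> [|i|l|l] s /= ->; split=> //=; lia.
Qed.

Lemma polytime_gate_args : polytime gate_args.
Proof.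
apply: (polytime_reencode (EB := Enc_tree) (f := fun g =>
  if gate_tag g == 1 then Node (tright (enc g)) Leaf else tright (enc g))); first by case.
  have m (l : seq nat) : meas_seq l = tsize (enc_seq enc_nat l) by elim: l => //= x l ->.
  by case=> //= l; rewrite -m.
have pr : polytime (fun g : gate => tright (enc g)).
  apply: (polytime_expr (e := ERight (EVar 0)) (K := fun x => meas x + meas x)).
  - by pbound_tac.
  - by case=> *; rewrite /=; lia.
  - by case=> [|i|l|l] s /= ->; split=> //=; lia.
have pt := polytime_gate_tag.
apply: polytime_if => //; first by ptime.
apply: (polytime_expr (e := ENode (ERight (EVar 0)) ELeaf) (K := fun x => 4 * meas x + 10)).
- by pbound_tac.
- by case=> *; rewrite /=; lia.
- by case=> [|i|l|l] s /= ->; split=> //=; lia.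
Qed.

Lemma is_inputE g : is_input g = (gate_tag g == 0). Proof. by case: g. Qed.

Lemma is_andE g : is_and g = (gate_tag g == 2). Proof. by case: g. Qed.

Lemma gate_valueE (U : seq nat) vs g : gate_value (mem U) vs g =
  if gate_tag g == 0 then has (fun i => i == size vs) U
  else if gate_tag g == 1 then ~~ nth false vs (nth 0 (gate_args g) 0)
  else if gate_tag g == 2 then all (fun i => nth false vs i) (gate_args g)
  else has (fun i => nth false vs i) (gate_args g).
Proof. by case: g => //=; rewrite has_pred1. Qed.

Lemma polytime_gate_values :
  polytime (fun x : seq gate * seq nat => gate_values (mem x.2) x.1).
Proof.
have pt := polytime_gate_tag; have pa := polytime_gate_args.
apply: (polytime_foldl (l := fun x : seq gate * seq nat => x.1) (z := fun=> [::])
  (f := fun x vs g => rcons vs (gate_value (mem x.2) vs g))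
  (G := fun x => meas x * 4 + 1)).
- by pbound_tac.
- by ptime.
- by ptime.
- apply: (polytime_ext (f := fun y : (seq gate * seq nat) * (seq bool * gate) =>
    y.2.1 ++ [:: if gate_tag y.2.2 == 0 then has (fun i => i == size y.2.1) y.1.2
      else if gate_tag y.2.2 == 1 then ~~ nth false y.2.1 (nth 0 (gate_args y.2.2) 0)
      else if gate_tag y.2.2 == 2 then all (fun i => nth false y.2.1 i) (gate_args y.2.2)
      else has (fun i => nth false y.2.1 i) (gate_args y.2.2)])).
    by move=> [[C U] [vs g]]; rewrite /= cats1 gate_valueE.
  by ptime.
- move=> [C U] n; rewrite [fst _]/= -/(gate_values _ _).
  apply: meas_seq_le => [|i x0 _]; last by case: (nth _ _ _).
  rewrite size_gate_values size_take; have := @size_le_meas _ Enc_gate C => /=.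
  by case: ifP; lia.
Qed.

(** As [t] is fixed, the recursion unfolds into a program depending on [t]. The base, written in
    unary, is the power of [(size D).+1] with exponent [2 ^ t]. *)
Lemma polytime_digits t :
  polytime (fun x : seq gate * (seq bool * nat) => digits t x.1 x.2.1 x.2.2) /\
  polytime (base t : seq gate -> nat).
Proof.
have pa := polytime_gate_args.
elim: t => [|t [IH1 IH2]] /=; first by split; ptime.
split; last by ptime.
have IH (A : Type) (EA : Enc A) (C : A -> seq gate) vs i : polytime C -> polytime vs -> polytime i ->
    polytime (fun a => digits t (C a) (vs a) (i a)).
  move=> hC hv hi.
  exact: (polytime_comp (f := fun a => (C a, (vs a, i a))) IH1
    (polytime_pair hC (polytime_pair hv hi))).
by ptime; apply: IH; ptime.
Qed.

Lemma polytime_decode t : polytime (fun x : seq gate * (nat * nat) => decode t x.1 x.2.1 x.2.2).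
Proof.
have pa := polytime_gate_args; have pt := polytime_gate_tag.
elim: t => [|t IH1] /=; first by ptime.
have [_ pb] := polytime_digits t.
have IH (A : Type) (EA : Enc A) (C : A -> seq gate) i x : polytime C -> polytime i -> polytime x ->
    polytime (fun a => decode t (C a) (i a) (x a)).
  move=> hC hi hx.
  exact: (polytime_comp (f := fun a => (C a, (i a, x a))) IH1
    (polytime_pair hC (polytime_pair hi hx))).
have pand : polytime is_and.
  by apply: (polytime_ext (f := fun g => gate_tag g == 2)); [move=> g; rewrite is_andE | ptime].
ptime; apply: IH; ptime; first [apply: polytime_modn | apply: polytime_divn]; ptime.
Qed.

Ltac ptime_with H := repeat (cbv beta; first [assumption | ptime_hyp | ptime1 | apply: H]).

Lemma polytime_input_nodes : polytime (input_nodes : seq gate -> seq nat).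
Proof.
have pt := polytime_gate_tag.
apply: (polytime_ext (f := fun C : seq gate =>
    [seq i <- iota 0 (size C) | gate_tag (nth GInput C i) == 0])).
  by move=> C; apply: eq_filter => i; rewrite is_inputE.
by ptime.
Qed.

Lemma polytime_input_tuples q : polytime (fun l => input_tuples l q).
Proof.
elim: q => [|q IH]; first by rewrite /=; ptime.
rewrite /=; ptime.
  exact: (polytime_comp (f := fun x : seq nat * nat => x.1) IH polytime_fst_id).
by rewrite /ltn /=; ptime.
Qed.

Section Closure.
Variable d : nat.
Context (A : Type) {EA : Enc A}.
Variables (C : A -> seq gate) (ws : A -> seq (seq nat)).
Hypotheses (hC : polytime C) (hws : polytime ws).

Lemma polytime_output_digits (U : A -> seq nat) : polytime U ->
  polytime (fun x => output_digits d (C x) (U x)).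
Proof.
move=> hU; have [pd _] := polytime_digits d.
apply: (polytime_comp (f := fun x => (C x, (gate_values (mem (U x)) (C x), (size (C x)).-1))) pd).
do 2?apply: polytime_pair => //; last by ptime.
exact: (polytime_comp (f := fun x => (C x, U x)) polytime_gate_values (polytime_pair hC hU)).
Qed.

Lemma polytime_next_sum (a : A -> nat) (x : A -> nat * seq nat) : polytime a -> polytime x ->
  polytime (fun y => next_sum d (C y) (ws y) (a y) (x y)).
Proof.
move=> ha hx; have [_ pb] := polytime_digits d.
have ho := polytime_output_digits (polytime_snd hx).
have hc : polytime (fun y => count_mem 1 (nth [::] (ws y) (a y))).
  by apply: (polytime_count (p := fun _ i => i == 1)); ptime.
by rewrite /next_sum /add_term; apply: polytime_modn; [ptime; apply: polytime_odd | ptime].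
Qed.

End Closure.

Section Closure2.
Variable d : nat.
Context (A : Type) {EA : Enc A}.
Variables (C : A -> seq gate) (ws : A -> seq (seq nat)).
Hypotheses (hC : polytime C) (hws : polytime ws).

Lemma polytime_common (a b : A -> nat) (x : A -> nat * seq nat) :
  polytime a -> polytime b -> polytime x ->
  polytime (fun y => common d (C y) (ws y) (a y) (b y) (x y)).
Proof.
move=> ha hb hx; have hn := polytime_next_sum d hC hws ha hx.
have hm (f : A -> seq nat) : polytime f -> polytime (fun y => twos (f y)).
  by move=> hf; rewrite /twos; ptime.
apply: polytime_pair; last by ptime.
apply: (polytime_mask 0); last by ptime.
by apply: (polytime_mask false); apply: hm; ptime.
Qed.

Lemma polytime_values (a : A -> nat) : polytime a ->
  polytime (fun y => values d (C y) (ws y) (a y)).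
Proof.
move=> ha; have pt := polytime_input_tuples (arity d); have pn := polytime_input_nodes.
have [_ pb] := polytime_digits d.
rewrite /values; apply: polytime_filter.
  by ptime; apply: (polytime_comp (f := fun x : A * nat => input_nodes (C x.1)) pt); ptime.
have hs : polytime (fun x : A * (nat * seq nat) => next_sum d (C x.1) (ws x.1) (a x.1) x.2).
  by apply: polytime_next_sum; ptime.
have hd := polytime_decode d.
apply: polytime_andb.
  by rewrite /twos; apply: polytime_eq; ptime.
apply: polytime_andb.
  apply: (polytime_ext (f := fun x : A * (nat * seq nat) => ~~ (a x.1 == 0) || (x.2.1 == 0))).
    by move=> x; rewrite implybE.
  by ptime.
apply: (polytime_ext (f := fun x : A * (nat * seq nat) => ~~ ((a x.1).+1 == size (ws x.1)) ||
    decode d (C x.1) (size (C x.1)).-1 (next_sum d (C x.1) (ws x.1) (a x.1) x.2))).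
  by move=> x; rewrite implybE.
ptime.
apply: (polytime_comp (f := fun x : A * (nat * seq nat) => (C x.1, ((size (C x.1)).-1,
   next_sum d (C x.1) (ws x.1) (a x.1) x.2))) hd).
by ptime.
Qed.

End Closure2.

(** * The complete reduction *)

Record wcs_input : Type := WcsInput { wcs_circuit : circuit; wcs_param : nat }.

Definition enc_wcs (x : wcs_input) : tree :=
  enc_instance (enc_circuit (wcs_circuit x)) (wcs_param x).

(** [3 ^ k] is the number of words of length [k]. With this summand the list of words has polynomial
    size, and a bound polynomial in the measure is an fpt time bound. *)
#[export] Instance Enc_wcs : Enc wcs_input :=
  {| enc := enc_wcs; meas := fun x => tsize (enc_wcs x) + 3 ^ wcs_param x;
     meas_ge := fun x => leq_addr _ _ |}.

Lemma polytime_wcs_circuit : polytime (wcs_circuit : wcs_input -> seq gate).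
Proof.
have m (C : seq gate) : meas_seq C = tsize (enc_seq enc_gate C) by elim: C => //= g C ->.
apply: (polytime_expr (e := ELeft (EVar 0)) (K := fun x => meas x + meas x)).
- by pbound_tac.
- by move=> [C k] /=; rewrite m /enc_circuit; lia.
- by move=> [C k] s /= ->; split=> //=; lia.
Qed.

Lemma polytime_wcs_param : polytime wcs_param.
Proof.
apply: (polytime_expr (e := ERight (EVar 0)) (K := fun x => meas x + meas x)).
- by pbound_tac.
- by move=> [C k] /=; lia.
- by move=> [C k] s /= ->; split=> //=; lia.
Qed.

Lemma meas_words n : meas (words n) <= 3 ^ n * (n * 6 + 1).+1 + 1.
Proof.
apply: (@meas_seq_le (seq nat) _ (words n)) => [|i x0 lt]; first by rewrite size_words.
have := mem_nth x0 lt; rewrite mem_words => /andP[/eqP sz al].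
apply: (@meas_seq_le nat _ (nth x0 (words n) i) n 5) => [|j y0 ltj]; first by rewrite sz.
rewrite [meas _]tsize_enc_nat.
by have := allP al _ (mem_nth y0 ltj) => /= h; lia.
Qed.

Lemma polytime_words (A : Type) {EA : Enc A} (f : A -> nat) :
  polytime f -> pbound (fun a => 3 ^ f a) -> polytime (fun a => words (f a)).
Proof.
move=> hf h3.
have fold k s : foldl (fun v (_ : unit) => word_step v) (words s) (nseq k tt) = words (s + k).
  by elim: k s => [|k IH] s; rewrite ?addn0 // addnS -addSn -IH.
apply: (polytime_ext (f := fun a => foldl (fun v _ => word_step v) (words 0) (nseq (f a) tt))).
  by move=> a; rewrite fold.
apply: (polytime_foldl (G := fun a => 3 ^ f a * (3 ^ f a * 6 + 1).+1 + 1)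
  (f := fun _ v (_ : unit) => word_step v)).
- by pbound_tac.
- by ptime.
- by ptime.
- by rewrite /word_step; ptime.
- move=> a n.
  have [k kf ->] : exists2 k, k <= f a & take n (nseq (f a) tt) = nseq k tt.
    have /all_pred1P e : all (pred1 tt) (take n (nseq (f a) tt)).
      by apply/allP => -[].
    by exists (size (take n (nseq (f a) tt))) => //; rewrite size_take size_nseq; case: ifP; lia.
  rewrite fold add0n; apply: leq_trans (meas_words k) _.
  have k3 : 3 ^ k <= 3 ^ f a by rewrite leq_exp2l.
  have fk : k <= 3 ^ f a by apply: leq_trans kf (ltnW (ltn_expl _ _)).
  by rewrite leq_add2r leq_mul // ltnS leq_add2r leq_mul2r fk.
Qed.

Definition tgd_reduction (d : nat) (sp : bool) (x : wcs_input) : seq (seq bool) * nat :=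
  let C := wcs_circuit x in
  let ws := short_words d (wcs_param x) in
  let m := size ws in
  let L := 2 * (m * m) + 2 in
  (double_matrix (conflict (common d C ws)) sp (vertices m L (0, [::]) (values d C ws)),
   2 * (2 * (m * L))).

Lemma polytime_tgd_reduction d sp : polytime (tgd_reduction d sp).
Proof.
have pC := polytime_wcs_circuit; have pk := polytime_wcs_param.
have pw0 : polytime (fun x => short_words d (wcs_param x)).
  apply: polytime_filter; last first.
    by rewrite /nonzeros; apply: polytime_leq; ptime.
  apply: polytime_words => //; exists 1 => x; rewrite expn1 /=; lia.
have pw (A : Type) (EA : Enc A) (f : A -> wcs_input) :
    polytime f -> polytime (fun a => short_words d (wcs_param (f a))).
  exact: (polytime_comp (f := f) pw0).
rewrite /tgd_reduction; apply: polytime_pair; last by ptime_with pw.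
pose V x := vertices (size (short_words d (wcs_param x)))
  (2 * (size (short_words d (wcs_param x)) * size (short_words d (wcs_param x))) + 2)
  (0, [::]) (values d (wcs_circuit x) (short_words d (wcs_param x))).
have pV : polytime V.
  rewrite /V /vertices /cells; apply: polytime_cat; first by ptime_with pw.
  apply: polytime_flatten; apply: polytime_map; first by ptime_with pw.
  apply: polytime_map; last by ptime.
  by apply: polytime_values; ptime_with pw.
pose W x := double (V x).
have pW : polytime W by rewrite /W /double; ptime.
rewrite /double_matrix.
apply: (polytime_map (l := W)) => //; apply: (polytime_map (l := fun y => W y.1)); first by ptime.
rewrite /double_rel; ptime.
by rewrite /conflict; ptime; apply: polytime_common; ptime_with pw.
Qed.

Lemma tgd_reductionP d sp C k (cls : sgraph -> Prop) : weft_class 1 d C ->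
  cls = (if sp then split_graph else bipartite) ->
  exists G, [/\ cls G, (tgd_reduction d sp (WcsInput C k)).1 = adj_matrix G &
    (exists a, weight a C = k /\ circuit_value a C) <->
    (exists G', [/\ cls G', enc_graph G = enc_graph G' &
      exists (l : nat) (v : l.-tuple 'I_(order G')),
        (tgd_reduction d sp (WcsInput C k)).2 <= l /\ total_dominating_sequence v])].
Proof.
move=> wC ->; rewrite /tgd_reduction /=.
set ws := short_words d k; set m := size ws; set L := 2 * (m * m) + 2.
pose phi := common d C ws; pose dom := values d C ws.
pose V := vertices m L (0, [::]) dom; pose r := conflict phi.
have r_sym : symmetric r := conflict_sym phi.
have clsG : (if sp then split_graph else bipartite) (double_graph sp r_sym V).
  case: (boolP sp) => [spT|/negbTE spF]; last exact: double_graph_bipartite.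
  apply: double_graph_split => //; apply: uniq_vertices => a; exact: uniq_values.
exists (double_graph sp r_sym V); split=> //; first by rewrite double_graphE.
split=> [[a [wa va]]|[G' [_ eG [l [v [lv tv]]]]]].
  have [u su] := solution_of_assignment wC wa va.
  have [ch un sz mem] := @solution_chainP _ _ m L phi (0, [::]) dom u su.
  have [v tv] := double_graph_tds sp r_sym ch un mem.
  exists (double_graph sp r_sym V); split=> //.
  by exists _, v; split=> //; rewrite sz.
have eM : adj_matrix G' = double_matrix r sp V.
  by rewrite -(double_graphE sp r_sym V); apply: (enc_seq_inj (enc_seq_inj enc_bool_inj)).
have [s [ch mem le]] := double_graph_chain r_sym eM tv.
have [|||u su] := @chain_solution _ _ m L phi (0, [::]) dom _ s ch mem.
- by move=> a x y am; exact: (common_inj wC).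
- by [].
(* The at most 2 pairs inside the clique shrink to 1 after halving, which is the slack allowed in
   [s_large]. *)
- have half x y : 2 * (2 * x) <= 2 * y + 2 -> 2 * x <= y.+1 by lia.
  exact: half (leq_trans lv le).
exact: (assignment_of_solution wC su).
Qed.

Lemma short_words_size_le d k : size (short_words d k) <= 3 ^ k.
Proof. by rewrite -size_words size_filter count_size. Qed.

(** * Computable bounds *)

Fixpoint clear (n : nat) : cmd :=
  if n is n'.+1 then Seq (Assign n' ELeaf) (clear n') else Skip.

Lemma exec_clear n s : exists t s', exec (clear n) s t s' /\
  forall j, s' j = if j < n then Leaf else s j.
Proof.
elim: n s => [|n IH] s; first by exists 1, s; split=> //; constructor.
have [t [s' [ex h]]] := IH (upd s n Leaf).
exists (2 + t).+1, s'; split; first exact: ExecSeq (ExecAssign s n ELeaf) ex.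
by move=> j; rewrite h updE ltnS [in RHS]leq_eqVlt; case: (j < n); case: (j == n).
Qed.

Record nat_pair : Type := NatPair { npair1 : nat; npair2 : nat }.

Definition enc_nat_pair (x : nat_pair) : tree := Node (enc_nat (npair1 x)) (enc_nat (npair2 x)).

#[export] Instance Enc_nat_pair : Enc nat_pair :=
  {| enc := enc_nat_pair; meas := fun x => tsize (enc_nat_pair x) + 3 ^ npair2 x;
     meas_ge := fun x => leq_addr _ _ |}.

Lemma polytime_npair1 : polytime npair1.
Proof.
apply: (polytime_expr (e := ELeft (EVar 0)) (K := fun x => meas x + meas x)).
- by pbound_tac.
- by move=> [u v] /=; lia.
- by move=> [u v] s /= ->; split=> //=; lia.
Qed.

Lemma polytime_npair2_exp : polytime (fun x => 3 ^ npair2 x).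
Proof.
apply: (polytime_ext (f := fun x => size (words (npair2 x)))).
  by move=> x; rewrite size_words.
apply: polytime_size; apply: polytime_words; last by exists 1 => x; rewrite expn1 /=; lia.
apply: (polytime_expr (e := ERight (EVar 0)) (K := fun x => meas x + meas x)).
- by pbound_tac.
- by move=> [u v] /=; lia.
- by move=> [u v] s /= ->; split=> //=; lia.
Qed.

Lemma polytime_expn_const (A : Type) {EA : Enc A} (f : A -> nat) c :
  polytime f -> polytime (fun a => f a ^ c).
Proof.
move=> hf; elim: c => [|c IH]; first exact: (polytime_const 1).
by apply: (polytime_ext (f := fun a => f a * f a ^ c)); [move=> a; rewrite expnS | ptime].
Qed.

(** Programs for [f] and [g] are specified only on a store that is empty outside variable 0. So the
    variables below [N] are cleared between the two runs, and the argument and the first result are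
    kept at [N] and [N.+1]. *)
Lemma computable_pair (h : nat_pair -> nat) (f g : nat -> nat) :
  polytime h -> computable f -> computable g -> computable (fun n => h (NatPair (f n) (g n))).
Proof.
move=> [ph [T [_ hh]]] [pf hf] [pg hg].
pose N := maxn 1 (maxn (cmd_bound pf) (cmd_bound pg)).
exists (Seq (Assign N (EVar 0)) (Seq pf (Seq (Assign N.+1 (EVar 0)) (Seq (clear N)
  (Seq (Assign 0 (EVar N)) (Seq pg (Seq (Assign 0 (ENode (EVar N.+1) (EVar 0))) ph))))))).
move=> n; have [t1 [sf ef sf0]] := hf n; have [t2 [sg eg sg0]] := hg n.
have N0 : (0 == N) = false by rewrite /N; lia.
pose s0 := upd (fun=> Leaf) 0 (enc_nat n).
pose s1 := upd s0 N (enc_nat n).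
have [r1 er1 ar1] := exec_agree ef (n := N) (r := s1) ltac:(rewrite /N; lia)
  ltac:(by move=> j jN; rewrite /s1 [in RHS]updE ltn_eqF).
have r1N : r1 N = enc_nat n by rewrite (exec_frame er1) /s1 ?updE ?eqxx // /N; lia.
have r10 : r1 0 = enc_nat (f n) by rewrite -ar1 // /N; lia.
pose s2 := upd r1 N.+1 (r1 0).
have [t3 [s3 [e3 h3]]] := exec_clear N s2.
have s3N : s3 N = enc_nat n by rewrite h3 ltnn /s2 updE (_ : (N == N.+1) = false) //; lia.
have s3N1 : s3 N.+1 = enc_nat (f n) by rewrite h3 ltnNge leqnSn /= /s2 updE eqxx.
pose s4 := upd s3 0 (s3 N).
have [r2 er2 ar2] := exec_agree eg (n := N) (r := s4) ltac:(rewrite /N; lia)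
  ltac:(by move=> j jN; rewrite /s4 !updE s3N h3 jN).
have r2N1 : r2 N.+1 = enc_nat (f n) by rewrite (exec_frame er2) /s4 ?updE // /N; lia.
have r20 : r2 0 = enc_nat (g n) by rewrite -ar2 // /N; lia.
pose s5 := upd r2 0 (Node (r2 N.+1) (r2 0)).
have [_ /(_ s5)] := hh (NatPair (f n) (g n)).
have -> : s5 0 = enc (NatPair (f n) (g n)) by rewrite /s5 updE eqxx r2N1 r20.
move=> /(_ erefl)[t6 [s6 [e6 _ h6]]].
have e1 : exec (Assign N (EVar 0)) s0 _ s1 := ExecAssign s0 N (EVar 0).
have e2 : exec (Assign N.+1 (EVar 0)) r1 _ s2 := ExecAssign r1 N.+1 (EVar 0).
have e4 : exec (Assign 0 (EVar N)) s3 _ s4 := ExecAssign s3 0 (EVar N).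
have e5 : exec (Assign 0 (ENode (EVar N.+1) (EVar 0))) r2 _ s5 :=
  ExecAssign r2 0 (ENode (EVar N.+1) (EVar 0)).
have e := ExecSeq e1 (ExecSeq er1 (ExecSeq e2 (ExecSeq e3 (ExecSeq e4
  (ExecSeq er2 (ExecSeq e5 e6)))))).
by eexists; exists s6; [exact: e | exact: h6].
Qed.

(** * Hardness *)

(** [X], a factor depending on the parameter times a power of [n], dominates both [t1] and the base
    of the bound on [t2]. Two more factors [X] absorb the sum, and the power of a product separates
    the parameter from [n]. *)
Lemma time_bound (f e n c c' t1 t2 s : nat) : 0 < n -> t1 <= f * n ^ c -> s <= n + t1 ->
  t2 <= (s + e).+2 ^ c' ->
  (t1 + t2).+1 <= (f + e + 4) ^ c'.+2 * n ^ (c.+1 * c'.+2).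
Proof.
move=> n0 le1 les le2; rewrite expnM -expnMn; set X := _ * n ^ c.+1.
have hn : n <= n ^ c.+1 by rewrite -{1}(expn1 n) leq_pexp2l.
have hc : n ^ c <= n ^ c.+1 by rewrite leq_pexp2l.
have h1 : 0 < n ^ c.+1 by rewrite expn_gt0 n0.
have hX : (s + e).+2 + 1 <= X /\ t1 + 2 <= X.
  have lf : f * n ^ c <= f * n ^ c.+1 by rewrite leq_mul2l hc orbT.
  have le : e <= e * n ^ c.+1 by rewrite leq_pmulr.
  by rewrite /X !mulnDl; move: (n ^ c.+1) (f * n ^ c.+1) (e * n ^ c.+1) hn lf le h1 => a b u; lia.
have X3 : 3 <= X by lia.
have p1 : t2 <= X ^ c'.
  apply: leq_trans le2 _; case: (c') => // q; rewrite leq_exp2r //; lia.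
have Y : 0 < X ^ c' by rewrite expn_gt0; apply/orP; left; lia.
rewrite !expnS; move: (X ^ c') p1 Y => Z p1 Y.
have h2 : X <= X * Z by rewrite leq_pmulr.
have h3 : Z <= X * Z by rewrite leq_pmull //; lia.
have h4 : 3 * (X * Z) <= X * (X * Z) by rewrite leq_mul2r X3 orbT.
lia.
Qed.

Lemma tgd_W1_hard sp (cls : sgraph -> Prop) :
  cls = (if sp then split_graph else bipartite) -> W1_hard (TotalGrundyDomination cls).
Proof.
move=> ecls P [d [p1 [f1 [g1 [c1 [cf cg red]]]]]].
have [p2 [T [[c2 hT] hp2]]] := polytime_tgd_reduction d sp.
have pn1 := polytime_npair1; have pn2 := polytime_npair2_exp.
exists (Seq p1 p2), (fun k => (f1 k + 3 ^ g1 k + 4) ^ c2.+2),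
  (* This is the target [2 * (2 * (m * L))] with [m] replaced by its bound [3 ^ g1 k]. *)
  (fun k => 2 * (2 * (3 ^ g1 k * (2 * (3 ^ g1 k * 3 ^ g1 k) + 2)))), (c1.+1 * c2.+2); split.
- apply: (computable_pair (h := fun x => (npair1 x + 3 ^ npair2 x + 4) ^ c2.+2)) cf cg.
  by apply: polytime_expn_const; ptime.
- apply: (computable_pair
    (h := fun x => 2 * (2 * (3 ^ npair2 x * (2 * (3 ^ npair2 x * 3 ^ npair2 x) + 2))))) cf cg.
  by ptime.
move=> x k /red[x' [k' [t1 [[s1 ex1 out1] le1 [C wC ex'] lek yes1]]]].
have e3 : 3 ^ k' <= 3 ^ g1 k by rewrite leq_exp2l.
have [_ /(_ s1)] := hp2 (WcsInput C k').
have -> : s1 0 = enc (WcsInput C k') by rewrite out1 ex'.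
move=> /(_ erefl)[t2 [s2 [ex2 le2 out2]]].
have [G [clsG eG yesG]] := tgd_reductionP k' wC ecls.
exists (enc_graph G), (tgd_reduction d sp (WcsInput C k')).2, (t1 + t2).+1; split.
- exists s2; first exact: ExecSeq ex1 ex2.
  by rewrite out2 /enc_graph -eG.
- apply: (@time_bound _ _ _ _ _ _ _ (tsize (enc_instance x' k'))) le1 _ _; first exact: tsize_gt0.
    by have := exec_size 0 ex1; rewrite updE eqxx out1; exact.
  apply: leq_trans le2 _; apply: leq_trans (hT _) _.
  case: (c2) => // c; rewrite leq_exp2r //= ex' /enc_wcs /=; lia.
- by exists G.
- rewrite /tgd_reduction /= !leq_pmul2l //.
  have le := leq_trans (short_words_size_le d k') e3.
  by rewrite leq_mul // leq_add2r leq_mul2l leq_mul.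
- rewrite yes1; split=> [[C' [_ eC [a ha]]]|[G' [cG' eG' h]]].
    move: eC; rewrite ex' => /enc_circuit_inj eC; rewrite -eC in ha.
    by have [G' [? ? ?]] := yesG.1 (ex_intro _ a ha); exists G'.
  by have [a ha] := yesG.2 (ex_intro _ G' (And3 cG' eG' h)); exists C; split=> //; exists a.
Qed.

Theorem theorem12 :
  W1_hard (TotalGrundyDomination bipartite) /\
  W1_hard (TotalGrundyDomination split_graph).
Proof. by split; [exact: (@tgd_W1_hard false) | exact: (@tgd_W1_hard true)]. Qed.
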